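(* Let $\Phi(x)=\mathbb{E}_{\xi\sim\mathcal P}[\phi(x,\xi)]$ be $L$-smooth, and assume $\max_{x\in\mathcal X,\ \xi\in\mathrm{supp}(\mathcal P)}\|\mathrm{grad}\,\phi(x,\xi)\|\le C$ for some constant $C\ge 0$. Run the algorithm SRFW (see context) from $x_0\in\mathcal X$ for $K\ge 1$ iterations with constant step sizes $\eta_k=\frac{1}{\sqrt K}$ and constant minibatch sizes $b_k=K$, and let $\hat x$ be its output. Then $$\mathbb{E}\left[\mathcal G(\hat x)\right]=O\left(\frac{1}{\sqrt K}\right),$$ i.e. there is a constant $c$, depending on the problem data ($\mathcal M,\mathcal X,\Phi,L,C$) and on $x_0$ but not on $K$, such that $\mathbb{E}[\mathcal G(\hat x)]\le c/\sqrt K$ for all $K\ge 1$. The expectation is over all sampled random variables and the random choice of the output.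
   Context: Setting: $\mathcal M$ is a Riemannian manifold with inner products $\langle\cdot,\cdot\rangle_x$ and norms $\|\cdot\|_x$ on tangent spaces $T_x\mathcal M$ and geodesic distance $d$. For $x,y\in\mathcal M$, $\mathrm{Exp}_x^{-1}(y)\in T_x\mathcal M$ is the inverse exponential map; it is assumed to be well defined for all points considered, with $\|\mathrm{Exp}_x^{-1}(y)\|_x=d(x,y)$, and ''the geodesic $\gamma:[0,1]\to\mathcal M$ with $\gamma(0)=x$, $\gamma(1)=y$'' is $\gamma(t)=\mathrm{Exp}_x(t\,\mathrm{Exp}_x^{-1}(y))$. $\Gamma_x^y:T_x\mathcal M\to T_y\mathcal M$ is parallel transport along this geodesic. $\mathcal X\subset\mathcal M$ is compact and geodesically convex (the geodesic between two points of $\mathcal X$ stays in $\mathcal X$). $\mathrm{grad}$ is the Riemannian gradient (in the first argument for $\phi(\cdot,\xi)$). A differentiable $f:\mathcal M\to\mathbb R$ is $L$-smooth if $\|\mathrm{grad}\,f(y)-\Gamma_x^y\,\mathrm{grad}\,f(x)\|\le L\,d(x,y)$ for all $x,y\in\mathcal M$. Stochastic gradients are unbiased: $\mathbb E_{\xi\sim\mathcal P}[\mathrm{grad}\,\phi(x,\xi)]=\mathrm{grad}\,\Phi(x)$. No convexity of $\Phi$ is assumed. Frank-Wolfe gap: $\mathcal G(x)=\max_{y\in\mathcal X}\langle\mathrm{Exp}_x^{-1}(y),-\mathrm{grad}\,\Phi(x)\rangle_x$. Algorithm SRFW: given $x_0\in\mathcal X$, a number of iterations $K$, minibatch sizes $b_k$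 and step sizes $\eta_k$, for $k=0,\dots,K-1$: draw $\xi_1,\dots,\xi_{b_k}$ i.i.d. from $\mathcal P$ (fresh, independent of the past); let $$y_k\in\operatorname{argmin}_{y\in\mathcal X}\Big\langle \tfrac{1}{b_k}\sum_{i=1}^{b_k}\mathrm{grad}\,\phi(x_k,\xi_i),\ \mathrm{Exp}_{x_k}^{-1}(y)\Big\rangle_{x_k};$$ set $x_{k+1}=\gamma(\eta_k)$, where $\gamma$ is the geodesic with $\gamma(0)=x_k$, $\gamma(1)=y_k$. The output $\hat x$ is chosen uniformly at random from $\{x_0,\dots,x_{K-1}\}$. *)

(* Defs.v *)
From HB Require Import structures.
From mathcomp Require Import all_boot all_order all_algebra.
From mathcomp Require Import all_classical all_reals all_analysis.
Set Implicit Arguments.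
Unset Strict Implicit.
Unset Printing Implicit Defensive.
Import Order.TTheory GRing.Theory Num.Theory numFieldNormedType.Exports.
Local Open Scope classical_set_scope.
Local Open Scope ring_scope.

(** * Smooth functions on an open subset of R^n *)

Fixpoint C_k (R : realType) (n k : nat) (U : set 'rV[R]_n)
    (f : 'rV[R]_n -> R) : Prop :=
  if k is k'.+1 then
    (forall u, U u -> differentiable f u) /\
    (forall a : 'I_n, C_k k' U ('D_(delta_mx 0 a) f))
  else forall u, U u -> {for u, continuous f}.

Definition smooth (R : realType) (n : nat) (U : set 'rV[R]_n)
    (f : 'rV[R]_n -> R) : Prop :=
  forall k, C_k k U f.

(** * Riemannian manifolds

  A tangent vector at [x] is represented by its coordinates, a row vector, in
  the preferred chart [chart_at x]. In the chart [i] these coordinates are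
  multiplied on the right by the Jacobian of the transition map (row vector
  convention of [jacobian]). The metric is given by its Gram matrices
  [gram i u] in all the charts, related by the transformation rule
  [gram_change]. *)

Record riemannian (R : realType) (n : nat) := Riemannian {
  carrier :> ptopologicalType;
  carrier_hausdorff : hausdorff_space carrier;
  carrier_second_countable : @second_countable carrier;
  chart : Type;
  dom : chart -> set carrier;
  coord : chart -> carrier -> 'rV[R]_n;
  point_of : chart -> 'rV[R]_n -> carrier;
  chart_at : carrier -> chart;
  mem_chart_at : forall x, dom (chart_at x) x;
  dom_open : forall i, open (dom i);
  img_open : forall i, open (coord i @` dom i);
  coordK : forall i x, dom i x -> point_of i (coord i x) = x;
  coord_continuous : forall i x, dom i x -> {for x, continuous (coord i)};
  point_of_continuous : forall i x, dom i x ->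
    {for coord i x, continuous (point_of i)};
  transition_smooth : forall i j (a : 'I_n),
    smooth (coord i @` (dom i `&` dom j))
           (fun u => coord j (point_of i u) 0 a);
  gram : chart -> 'rV[R]_n -> 'M[R]_n;
  gram_smooth : forall i (a b : 'I_n),
    smooth (coord i @` dom i) (fun u => gram i u a b);
  gram_sym : forall i x, dom i x -> (gram i (coord i x))^T = gram i (coord i x);
  gram_pos : forall i x (v : 'rV[R]_n), dom i x -> v != 0 ->
    0 < (v *m gram i (coord i x) *m v^T) 0 0;
  gram_change : forall i j x, dom i x -> dom j x ->
    let J := 'J (coord j \o point_of i) (coord i x) in
    gram i (coord i x) = J *m gram j (coord j x) *m J^T
}.

Section Geometry.
Context {R : realType} {n : nat} {M : riemannian R n}.
Implicit Types (x y : M) (u v w : 'rV[R]_n) (gam : R -> M).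

Definition inner x v w : R :=
  (v *m gram (chart_at x) (coord (chart_at x) x) *m w^T) 0 0.

Definition tnorm x v : R := Num.sqrt (inner x v v).

(* coordinates in the chart i of the tangent vector v at x *)
Definition in_chart (i : chart M) x v : 'rV[R]_n :=
  v *m 'J (coord i \o point_of (chart_at x)) (coord (chart_at x) x).

(* Curves on [0, 1] are restrictions of curves on a slightly larger open
   interval, so that derivatives at the end points are two-sided. C^1 curves on
   [0, 1], geodesics and parallel fields all extend in this way. *)
Definition around01 (Q : R -> Prop) : Prop :=
  exists2 e : R, 0 < e & forall t, - e < t < 1 + e -> Q t.

Definition velocity gam (t : R) : 'rV[R]_n :=
  derive1 (coord (chart_at (gam t)) \o gam) t.

Definition C1_arc gam : Prop :=
  around01 (fun t => {for t, continuous gam} /\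
    forall i, dom i (gam t) ->
      let c := coord i \o gam in
      derivable c t 1 /\ {for t, continuous (derive1 c)}).

Definition arc_length gam : R :=
  \int[lebesgue_measure]_(t in `[0, 1]) tnorm (gam t) (velocity gam t).

(* A piecewise C^1 curve is a finite chain of C^1 arcs, each parametrized by
   [0, 1]: [pw_curve x y l] says that such a curve of length l joins x to y. *)
Inductive pw_curve : M -> M -> R -> Prop :=
| pw_nil x : pw_curve x x 0
| pw_cons gam y l : C1_arc gam -> pw_curve (gam 1) y l ->
    pw_curve (gam 0) y (arc_length gam + l).

Definition dist x y : \bar R := ereal_inf [set l%:E | l in pw_curve x y].

(** ** Levi-Civita connection *)

Definition dgram (i : chart M) u (c a b : 'I_n) : R :=
  'D_(delta_mx 0 c) (fun u' => gram i u' a b) u.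

Definition christoffel (i : chart M) u (k a b : 'I_n) : R :=
  2^-1 * \sum_(l < n) invmx (gram i u) k l *
    (dgram i u a l b + dgram i u b l a - dgram i u l a b).

Definition christoffel_form (i : chart M) u v w : 'rV[R]_n :=
  \row_k \sum_(a < n) \sum_(b < n) christoffel i u k a b * v 0 a * w 0 b.

Definition is_geodesic gam : Prop :=
  around01 (fun t => {for t, continuous gam} /\
    forall i, dom i (gam t) ->
      let c := coord i \o gam in
      [/\ derivable c t 1, derivable (derive1 c) t 1 &
          derive1 (derive1 c) t = - christoffel_form i (c t) (derive1 c t) (derive1 c t)]).

(* V t is a tangent vector at gam t *)
Definition is_parallel gam (V : R -> 'rV[R]_n) : Prop :=
  around01 (fun t => forall i, dom i (gam t) ->
    let c := coord i \o gam in
    let W := fun s => in_chart i (gam s) (V s) in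
    derivable W t 1 /\
    derive1 W t = - christoffel_form i (c t) (derive1 c t) (W t)).

(* w is the parallel transport of v along gam, from gam 0 to gam 1 *)
Definition transported gam v w : Prop :=
  exists V, [/\ is_parallel gam V, V 0 = v & V 1 = w].

(** ** Exponential map *)

(* Exp_x is a partial function, given by its graph: Exp_x(v) = y *)
Definition is_exp x v y : Prop :=
  exists gam, [/\ is_geodesic gam, gam 0 = x, velocity gam 0 = v & gam 1 = y].

Definition is_log x y v : Prop := is_exp x v y /\ (tnorm x v)%:E = dist x y.

(* Exp_x^{-1}(y) is well defined *)
Definition log_defined x y : Prop := exists! v, is_log x y v.

(* Exp_x^{-1}(y); meaningful under [log_defined x y] *)
Definition Log x y : 'rV[R]_n := xget 0 (is_log x y).

(* gam is the geodesic t |-> Exp_x(t Exp_x^{-1}(y)) from x to y *)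
Definition geodesic_to x y gam : Prop :=
  [/\ is_geodesic gam, gam 0 = x, gam 1 = y & velocity gam 0 = Log x y].

Definition geodesically_convex (X : set M) : Prop :=
  forall x y gam, X x -> X y -> geodesic_to x y gam ->
  forall t, 0 <= t <= 1 -> X (gam t).

(** ** Gradients *)

Definition mdifferentiable (f : M -> R) x : Prop :=
  differentiable (f \o point_of (chart_at x)) (coord (chart_at x) x).

(* grad^k = sum_a g^{ak} d_a f; meaningful under [mdifferentiable f x] *)
Definition grad (f : M -> R) x : 'rV[R]_n :=
  let i := chart_at x in
  (\row_a 'D_(delta_mx 0 a) (f \o point_of i) (coord i x)) *m
  invmx (gram i (coord i x)).

(* The parallel transport w of grad f x along gam exists and is unique (linear
   differential equation). *)
Definition L_smooth (L : R) (f : M -> R) : Prop :=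
  (forall x, mdifferentiable f x) /\
  forall x y gam, log_defined x y -> geodesic_to x y gam ->
    exists2 w, transported gam (grad f x) w &
      ((tnorm y (grad f y - w))%:E <= L%:E * dist x y)%E.

(* The maximum over X is written as a supremum; it is attained when X is compact
   and geodesically convex and [log_defined x y] for all x, y in X. *)
Definition fw_gap (X : set M) (f : M -> R) x : R :=
  sup [set inner x (Log x y) (- grad f x) | y in X].

End Geometry.

(** * Stochastic Riemannian Frank-Wolfe *)

Definition borel (R : realType) (n : nat) (M : riemannian R n) :=
  g_sigma_algebraType (@open M).

Section SRFW.
Context {R : realType} {n : nat} {M : riemannian R n}.
Context {d : measure_display} {Xi : measurableType d}.
Context {d' : measure_display} {Omega : measurableType d'}.
Implicit Types (x y : nat -> Omega -> borel M) (xi : nat -> nat -> Omega -> Xi).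

(* Generators of the sigma-algebra of the past of iteration k: the iterates
   x_0..x_k, and the minimizers and samples of the iterations before k. *)
Definition past x y xi (b : nat -> nat) (k : nat) : set (set Omega) :=
  [set A | (exists j U, [/\ (j <= k)%N, measurable U & A = x j @^-1` U]) \/
           (exists j U, [/\ (j < k)%N, measurable U & A = y j @^-1` U]) \/
           (exists j i B, [/\ (j < k)%N, (i < b j)%N, measurable B &
                              A = xi j i @^-1` B])].

(* The samples xi k 0 .. xi k (b k - 1) are i.i.d. with law P and jointly
   independent of the past. *)
Definition fresh_batch (P : probability Xi R) (Pr : probability Omega R)
    x y xi b k : Prop :=
  forall A, <<s past x y xi b k >> A ->
  forall B : 'I_(b k) -> set Xi, (forall i, measurable (B i)) ->
    Pr (A `&` [set w | forall i : 'I_(b k), B i (xi k i w)]) =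
    (Pr A * \prod_(i < b k) P (B i))%E.

Definition minibatch_grad (phi : M -> Xi -> R) x xi (b : nat -> nat) k w :
    'rV[R]_n :=
  (b k)%:R^-1 *: \sum_(i < b k) grad (phi^~ (xi k i w)) (x k w).

Record srfw_run (X : set M) (P : probability Xi R) (phi : M -> Xi -> R)
    (x0 : M) (K : nat) (b : nat -> nat) (eta : nat -> R)
    (Pr : probability Omega R) x y xi : Prop := SrfwRun {
  run_measurable_x : forall k, (k <= K)%N -> measurable_fun setT (x k);
  run_measurable_y : forall k, (k < K)%N -> measurable_fun setT (y k);
  run_measurable_xi : forall k i, (k < K)%N -> (i < b k)%N ->
    measurable_fun setT (xi k i);
  run_init : forall w, x 0%N w = x0;
  run_draw : forall k, (k < K)%N -> fresh_batch P Pr x y xi b k;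
  run_argmin : forall k w, (k < K)%N ->
    X (y k w) /\
    forall z, X z ->
      inner (x k w) (minibatch_grad phi x xi b k w) (Log (x k w) (y k w)) <=
      inner (x k w) (minibatch_grad phi x xi b k w) (Log (x k w) z);
  run_step : forall k w, (k < K)%N ->
    exists2 gam, @geodesic_to R n M (x k w) (y k w) gam &
                 x k.+1 w = gam (eta k)
}.

(* kappa is uniform on {0, .., K-1} and independent of the whole run *)
Definition uniform_output (K : nat) (b : nat -> nat) (Pr : probability Omega R)
    x y xi (kappa : Omega -> 'I_K) : Prop :=
  forall j : 'I_K, measurable (kappa @^-1` [set j]) /\
  forall A, <<s past x y xi b K >> A ->
    Pr (A `&` kappa @^-1` [set j]) = (Pr A * (K%:R^-1)%:E)%E.

End SRFW.

(* Main.v *)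
From Pilot Require Import Defs.
From HB Require Import structures.
From mathcomp Require Import finmap.
From mathcomp Require Import all_boot all_order all_algebra.
From mathcomp Require Import all_classical all_reals all_analysis.
From mathcomp Require Import measurable_realfun ring lra.
(* [coord] denotes chart coordinates below, not coordinates in a basis. *)
Import Pilot.Defs.

(** The gap at an iterate is paid for by the decrease of [Phi] during the next
  step, up to the error of the sampled gradient.

  Smoothness is turned into a quadratic upper bound along geodesics ([descent]).
  The Levi-Civita connection is compatible with the metric
  ([christoffel_form_compatible]), so that inner products of parallel fields
  are constant ([parallel_inner_cst]); in particular geodesics have constant
  speed. The geodesic from [x] to [y] given by the logarithm is minimizing, hence
  so are its initial pieces, and the logarithm of a point [gam t] of it is
  [t *: Log x y] ([Log_geodesic]). The smoothness assumption therefore applies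
  between [x] and [gam t]; it bounds the derivative of [Phi] at time [t] by
  [<grad Phi x, Log x y> + L t |Log x y|^2], and integration in [t] gives the
  bound.

  With [s = sqrt K], step size [1 / s] and error [delta] of the minibatch
  gradient, minimality of [y_k] for the sampled linear form yields
  [gap <= s (Phi x_k - Phi x_(k+1)) + 2 D |delta| + |L| D^2 / (2 s)], where [D]
  bounds the distances in [X]. Such a [D] exists by compactness
  ([compact_dist_bounded]), because straight segments of charts have locally
  bounded length. As [2 |delta| <= s |delta|^2 + 1 / s], only the second moment of
  the error matters ([frank_wolfe_step]).

  The squared error is [K^-2] times the sum over pairs [(i, j)] of samples of
  inner products of the noises. A noise has norm at most [2 C] and mean zero, and
  [(x_k, xi_i)] is independent of [xi_j] for distinct [i] and [j], so that Fubini
  kills the off-diagonal pairs; the [K] diagonal ones contribute at most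
  [4 C^2] each, hence the second moment is at most [4 C^2 / K]
  ([pairing_sum_le]). Fubini requires the inner product of two sampled gradients
  to be jointly measurable in the point and the samples: in a fixed chart partial
  derivatives are limits of difference quotients ([measurable_partial]), and
  finitely many charts cover [X].

  The output index is independent of the run, so the expected gap is the average
  of the expected bounds over the iterates ([Rint_indep_event]); the decreases
  telescope and all other terms are of order [1 / s] ([expected_gap_le]). The gap
  itself is a supremum over [X] that need not be measurable. It is nonnegative,
  and the integral of a nonnegative function is monotone without measurability
  ([ge0_le_integral_nonmeas]), so only the bound has to be measurable. *)

Set Implicit Arguments.
Unset Strict Implicit.
Unset Printing Implicit Defensive.
Import Order.TTheory GRing.Theory Num.Theory numFieldNormedType.Exports.
Local Open Scope classical_set_scope.
Local Open Scope ring_scope.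

(** * Calculus of vector-valued functions *)

Section calculus.
Context {R : realType}.

Lemma is_derive_diff_comp (U V : normedModType R) (F : U -> V) (c : R -> U)
    (t : R) (dc : U) :
  is_derive t 1 c dc -> differentiable F (c t) ->
  is_derive t 1 (F \o c) ('d F (c t) dc).
Proof.
move=> [/derivable1_diffP dct dcE] dF.
have dFc : differentiable (F \o c) t by exact: differentiable_comp.
apply: DeriveDef; first exact/derivable1_diffP.
by rewrite deriveE// diff_comp//= -dcE deriveE.
Qed.

Lemma derive_row_entry (V : normedModType R) n (f : V -> 'rV[R]_n) x v a :
  derivable f x v -> is_derive x v (fun u => f u 0 a) ('D_v f x 0 a).
Proof.
move=> df; apply: DeriveDef; first by move/derivable_mxP: df; apply.
by rewrite derive_mx// mxE.
Qed.

(** A row-valued function is the sum of its entries times the basis vectors. *)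
Lemma differentiable_row (V : normedModType R) n (f : V -> 'rV[R]_n) x :
  (forall a, differentiable (fun u => f u 0 a) x) -> differentiable f x.
Proof.
move=> df.
have -> : f = \sum_(a < n) (fun u => f u 0 a *: delta_mx 0 a).
  apply/funext => u; rewrite fct_sumE [LHS]row_sum_delta.
  by apply: eq_bigr.
by apply: differentiable_sum => a; exact: differentiableZl.
Qed.

Lemma diff_row_entry (V : normedModType R) n (f : V -> 'rV[R]_n) x v a :
  differentiable f x -> ('d f x v) 0 a = 'd (fun u => f u 0 a) x v.
Proof.
move=> df.
have da : differentiable (fun u => f u 0 a) x.
  apply: (@differentiable_comp _ _ _ _ f (fun M : 'rV[R]_n => M 0 a : R)) => //.
  exact: differentiable_coord.
rewrite -!deriveE//; have := derive_row_entry a (@diff_derivable _ _ _ f x v df).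
by move=> [_ ->].
Qed.

Lemma diff_basis n (V : normedModType R) (F : 'rV[R]_n -> V) u v :
  differentiable F u ->
  'd F u v = \sum_(a < n) v 0 a *: 'D_(delta_mx 0 a) F u.
Proof.
move=> dF; rewrite {1}[v]row_sum_delta raddf_sum; apply: eq_bigr => a _.
by rewrite [LHS]linearZ/= deriveE.
Qed.

Lemma near_eq_derive1 (V : normedModType R) (f g : R -> V) (t : R) :
  (\near t, f t = g t) -> derive1 f t = derive1 g t.
Proof. by move=> fg; rewrite !derive1E; exact: near_eq_derive. Qed.

Lemma is_derive1P (V : normedModType R) (f : R -> V) (t : R) :
  derivable f t 1 -> is_derive t 1 f (derive1 f t).
Proof. by move=> ft; rewrite derive1E; exact: derivableP. Qed.

Lemma is_derive1E (V : normedModType R) (f : R -> V) (t : R) df :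
  is_derive t 1 f df -> derive1 f t = df.
Proof. by move=> [_ <-]; rewrite derive1E. Qed.

(** The expansion that defines differentiability is local. *)
Lemma near_eq_differentiable (U V : normedModType R) (f g : U -> V) x :
  (\near x, f x = g x) -> differentiable f x -> differentiable g x.
Proof.
move=> fg df; have fgx := nbhs_singleton fg.
pose d : {linear U -> V} := 'd f x.
have dc : continuous d by exact: diff_continuous.
have fg0 : \forall h \near (0 : U), f (h + x) = g (h + x).
  by move: fg; rewrite (near_shift 0 x) subr0.
have E : g \o shift x = cst (g x) + d +o_ 0 id.
  apply/eqaddoP => e e0; have /diff_locally/eqaddoP/(_ e e0) := df.
  apply: filterS2 fg0 => h hE.
  by rewrite !fctE /= hE fgx.
by apply/diff_locallyP; rewrite (diff_unique dc E).
Qed.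

End calculus.

Section scalar_rules.
Context {R : realType}.

Lemma is_derive_mul (f g : R -> R) (t df dg : R) :
  is_derive t 1 f df -> is_derive t 1 g dg ->
  is_derive t 1 (fun s => f s * g s) (df * g t + f t * dg).
Proof.
move=> hf hg; have := is_deriveM hf hg.
rewrite (_ : f t *: dg + g t *: df = df * g t + f t * dg)//.
by rewrite /GRing.scale/= addrC mulrC.
Qed.

Lemma is_derive_bigsum n (f : 'I_n -> R -> R) (t : R) (df : 'I_n -> R) :
  (forall k, is_derive t 1 (f k) (df k)) ->
  is_derive t 1 (fun s => \sum_(k < n) f k s) (\sum_(k < n) df k).
Proof.
move=> hf; have -> : (fun s => \sum_(k < n) f k s) = \sum_(k < n) f k.
  by apply/funext => s; rewrite fct_sumE.
exact: is_derive_sum.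
Qed.

Lemma is_derive_entry n (f : R -> 'rV[R]_n) (t : R) df a :
  is_derive t 1 f df -> is_derive t 1 (fun s => f s 0 a) (df 0 a).
Proof. by move=> [hf <-]; exact: derive_row_entry. Qed.

Lemma gram_formE n (v w : 'rV[R]_n) (G : 'M[R]_n) :
  (v *m G *m w^T) 0 0 = \sum_b (\sum_a v 0 a * G a b) * w 0 b.
Proof. by rewrite mxE; apply: eq_bigr => b _; rewrite !mxE. Qed.

End scalar_rules.

(** * Charts and the metric *)

Section charts.
Context {R : realType} {n : nat} {M : riemannian R n}.
Implicit Types (x y : M) (i j : chart M) (u v w : 'rV[R]_n) (gam : R -> M).

Definition transition i j : 'rV[R]_n -> 'rV[R]_n := coord j \o point_of i.

Lemma near_dom i x : dom i x -> \forall y \near x, dom i y.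
Proof. by move=> ix; apply: open_nbhs_nbhs; split => //; exact: dom_open. Qed.

Lemma near_img i x : dom i x -> \forall u \near coord i x, (coord i @` dom i) u.
Proof.
move=> ix; apply: open_nbhs_nbhs; split; first exact: img_open.
by exists x.
Qed.

Lemma near_point_of i x (P : set M) : dom i x -> (\forall y \near x, P y) ->
  \forall u \near coord i x, P (point_of i u).
Proof. by move=> ix; rewrite -{1}(coordK ix) => /(point_of_continuous ix). Qed.

Lemma transition_differentiable i j x : dom i x -> dom j x ->
  differentiable (transition i j) (coord i x).
Proof.
move=> ix jx; apply: differentiable_row => a.
have [+ _] := @transition_smooth _ _ M i j a 1.
by apply; exists x.
Qed.

Lemma near_coord_transition i j gam (t : R) : dom i (gam t) ->
  {for t, continuous gam} ->
  \forall s \near t, (transition i j \o (coord i \o gam)) s = (coord j \o gam) s.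
Proof.
move=> it gt.
have : \forall s \near t, dom i (gam s) by exact: (gt _ (near_dom it)).
by apply: filterS => s is_; rewrite /transition /= coordK.
Qed.

Lemma is_derive_chart_change i j gam (t : R) dc :
  dom i (gam t) -> dom j (gam t) -> {for t, continuous gam} ->
  is_derive t 1 (coord i \o gam) dc ->
  is_derive t 1 (coord j \o gam) (dc *m 'J (transition i j) (coord i (gam t))).
Proof.
move=> it jt gt dct.
apply: (near_eq_is_derive (near_coord_transition j it gt)).
rewrite mul_rV_lin1.
by apply: is_derive_diff_comp => //; exact: transition_differentiable.
Qed.

(** The velocity is read in the preferred chart of the current point; going to
  that chart and back does not change the derivative. *)
Lemma in_chart_velocity i gam (t : R) dc :
  dom i (gam t) -> {for t, continuous gam} ->
  is_derive t 1 (coord i \o gam) dc -> in_chart i (gam t) (velocity gam t) = dc.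
Proof.
move=> it gt dct.
have ct := mem_chart_at (gam t).
have d1 := is_derive_chart_change it ct gt dct.
have d2 := is_derive_chart_change ct it gt d1.
rewrite /velocity (is_derive1E d1).
by rewrite -[RHS](is_derive1E dct) (is_derive1E d2).
Qed.

End charts.

Section metric.
Context {R : realType} {n : nat} {M : riemannian R n}.
Implicit Types (x y : M) (i j : chart M) (u v w : 'rV[R]_n).

(** A row vector annihilated by the Gram matrix has zero length. *)
Lemma gram_unit i x : dom i x -> gram i (coord i x) \in unitmx.
Proof.
move=> ix; rewrite -row_free_unit -kermx_eq0; apply/eqP/row_matrixP => a.
rewrite row0; apply: contraTeq isT => va0.
have := gram_pos ix va0.
have /sub_kermxP -> := row_sub a (kermx (gram i (coord i x))).
by rewrite mul0mx mxE ltxx.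
Qed.

(** The rule [gram_change] says exactly that changes of charts are isometries. *)
Lemma inner_in_chart i x v w : dom i x ->
  inner x v w = (in_chart i x v *m gram i (coord i x) *m (in_chart i x w)^T) 0 0.
Proof.
move=> ix; rewrite /inner (gram_change (mem_chart_at x) ix) /in_chart.
by rewrite trmx_mul !mulmxA.
Qed.

Lemma innerC x v w : inner x v w = inner x w v.
Proof.
rewrite /inner.
have tr00 (A : 'M[R]_1) : A 0 0 = A^T 0 0 by rewrite mxE.
by rewrite tr00 !trmx_mul trmxK (gram_sym (mem_chart_at x)) mulmxA.
Qed.

Lemma innerDl x v v' w : inner x (v + v') w = inner x v w + inner x v' w.
Proof. by rewrite /inner !mulmxDl mxE. Qed.

Lemma innerZl x (a : R) v w : inner x (a *: v) w = a * inner x v w.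
Proof. by rewrite /inner -!scalemxAl mxE. Qed.

Lemma innerDr x v w w' : inner x v (w + w') = inner x v w + inner x v w'.
Proof. by rewrite innerC innerDl ![inner x _ v]innerC. Qed.

Lemma innerZr x (a : R) v w : inner x v (a *: w) = a * inner x v w.
Proof. by rewrite innerC innerZl innerC. Qed.

Lemma innerNl x v w : inner x (- v) w = - inner x v w.
Proof. by rewrite -scaleN1r innerZl mulN1r. Qed.

Lemma innerNr x v w : inner x v (- w) = - inner x v w.
Proof. by rewrite -scaleN1r innerZr mulN1r. Qed.

Lemma inner0l x w : inner x 0 w = 0.
Proof. by rewrite -(scale0r w) innerZl mul0r. Qed.

Lemma inner0r x w : inner x w 0 = 0.
Proof. by rewrite innerC inner0l. Qed.

Lemma inner_suml x m (F : 'I_m -> 'rV[R]_n) w :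
  inner x (\sum_k F k) w = \sum_k inner x (F k) w.
Proof.
exact: (big_morph (inner x ^~ w) (fun a b => innerDl x a b w) (inner0l x w)).
Qed.

Lemma inner_sumr x m (F : 'I_m -> 'rV[R]_n) w :
  inner x w (\sum_k F k) = \sum_k inner x w (F k).
Proof. by rewrite innerC inner_suml; apply: eq_bigr => k _; rewrite innerC. Qed.

Lemma inner_gt0 x v : v != 0 -> 0 < inner x v v.
Proof. exact: (gram_pos (mem_chart_at x)). Qed.

Lemma inner_ge0 x v : 0 <= inner x v v.
Proof.
by have [->|/inner_gt0-/(_ x)/ltW//] := eqVneq v 0; rewrite inner0l.
Qed.

Lemma tnorm_ge0 x v : 0 <= tnorm x v. Proof. exact: sqrtr_ge0. Qed.

Lemma tnorm_sqr x v : tnorm x v ^+ 2 = inner x v v.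
Proof. by rewrite sqr_sqrtr// inner_ge0. Qed.

Lemma tnorm_eq0 x v : tnorm x v = 0 -> v = 0.
Proof.
move=> v0; apply: contra_eq v0 => /(inner_gt0 x); rewrite -tnorm_sqr => h.
by apply: contraTneq h => ->; rewrite expr0n ltxx.
Qed.

Lemma tnormZ x (a : R) v : 0 <= a -> tnorm x (a *: v) = a * tnorm x v.
Proof.
move=> a0; rewrite /tnorm innerZl innerZr mulrA -expr2 sqrtrM ?sqr_ge0//.
by rewrite sqrtr_sqr ger0_norm.
Qed.

Lemma tnormN x v : tnorm x (- v) = tnorm x v.
Proof. by rewrite /tnorm innerNl innerNr opprK. Qed.

Lemma inner_le_tnorm x v w : inner x v w <= tnorm x v * tnorm x w.
Proof.
have [->|v0] := eqVneq v 0; first by rewrite inner0l mulr_ge0// tnorm_ge0.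
have [->|w0] := eqVneq w 0; first by rewrite inner0r mulr_ge0// tnorm_ge0.
have nv : 0 < tnorm x v by rewrite sqrtr_gt0 inner_gt0.
have nw : 0 < tnorm x w by rewrite sqrtr_gt0 inner_gt0.
have := inner_ge0 x (tnorm x w *: v - tnorm x v *: w).
rewrite !(innerDl, innerDr, innerNl, innerNr, innerZl, innerZr) -!tnorm_sqr.
rewrite (innerC x w v).
move: (tnorm x v) (tnorm x w) (inner x v w) nv nw => a b c a0 b0 h.
have : 0 <= (a * b) * (a * b - c) by nra.
by rewrite pmulr_rge0 ?mulr_gt0// subr_ge0.
Qed.

Lemma norm_inner_le x v w : `|inner x v w| <= tnorm x v * tnorm x w.
Proof.
rewrite ler_norml inner_le_tnorm andbT lerNl -innerNl.
by rewrite -(tnormN x v) inner_le_tnorm.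
Qed.

Lemma tnormD x v w : tnorm x (v + w) <= tnorm x v + tnorm x w.
Proof.
rewrite -(ler_pXn2r (n := 2))// ?nnegrE ?addr_ge0 ?tnorm_ge0//.
rewrite tnorm_sqr !(innerDl, innerDr) -!tnorm_sqr (innerC x w v).
have := inner_le_tnorm x v w; lra.
Qed.

Lemma inner_grad (f : M -> R) x w : mdifferentiable f x ->
  inner x (grad f x) w = 'd (f \o point_of (chart_at x)) (coord (chart_at x) x) w.
Proof.
move=> df; rewrite /inner /grad mulmxKV ?gram_unit//; last exact: mem_chart_at.
rewrite diff_basis// mxE; apply: eq_bigr => a _.
by rewrite !mxE mulrC.
Qed.

End metric.

(** * Compatibility of the connection with the metric *)

Section connection.
Context {R : realType} {n : nat} {M : riemannian R n}.
Implicit Types (x y : M) (i j : chart M) (u v w p : 'rV[R]_n) (gam : R -> M).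

Lemma gram_entry_sym i x a b : dom i x ->
  gram i (coord i x) a b = gram i (coord i x) b a.
Proof. by move=> ix; rewrite -[in LHS](gram_sym ix) mxE. Qed.

Lemma dgram_sym i x c a b : dom i x ->
  dgram i (coord i x) c a b = dgram i (coord i x) c b a.
Proof.
move=> ix; apply: near_eq_derive; apply: filterS (near_img ix) => _ [y iy <-].
exact: gram_entry_sym.
Qed.

Lemma gram_differentiable i x a b : dom i x ->
  differentiable (fun u => gram i u a b) (coord i x).
Proof.
move=> ix; have [+ _] := @gram_smooth _ _ M i a b 1.
by apply; exists x.
Qed.

(** Lowering the upper index removes the inverse of the Gram matrix. *)
Lemma christoffel_lower i x a b m : dom i x ->
  let u := coord i x in
  \sum_k christoffel i u k a b * gram i u k m =
  2^-1 * (dgram i u a m b + dgram i u b m a - dgram i u m a b).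
Proof.
move=> ix u; pose S l := dgram i u a l b + dgram i u b l a - dgram i u l a b.
transitivity (2^-1 * \sum_l S l * (\sum_k gram i u m k * invmx (gram i u) k l)).
  under eq_bigr do rewrite /christoffel -mulrA mulr_suml.
  rewrite -mulr_sumr; congr (_ * _); rewrite exchange_big/=.
  apply: eq_bigr => l _; rewrite mulr_sumr; apply: eq_bigr => k _.
  by rewrite (gram_entry_sym _ _ ix) /S; ring.
congr (_ * _); have := mulmxV (gram_unit ix); rewrite -/u => /matrixP VG.
have VGE l : \sum_k gram i u m k * invmx (gram i u) k l = (m == l)%:R.
  by have := VG m l; rewrite !mxE.
rewrite (bigD1 m)//= [X in _ + X]big1 => [|l /negPf lm].
  by rewrite VGE eqxx mulr1 addr0.
by rewrite VGE eq_sym lm mulr0.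
Qed.

Lemma christoffel_form_gram i x p v w : dom i x ->
  let u := coord i x in
  (christoffel_form i u p v *m gram i u *m w^T) 0 0 =
  \sum_m \sum_a \sum_b 2^-1 * (p 0 a * v 0 b * w 0 m *
    (dgram i u a m b + dgram i u b m a - dgram i u m a b)).
Proof.
move=> ix u; rewrite gram_formE; apply: eq_bigr => m _.
under eq_bigr => k _.
  rewrite mxE mulr_suml; under eq_bigr do rewrite mulr_suml.
  over.
rewrite exchange_big mulr_suml; apply: eq_bigr => a _ /=.
rewrite exchange_big mulr_suml; apply: eq_bigr => b _ /=.
transitivity (p 0 a * v 0 b * w 0 m *
   \sum_k christoffel i u k a b * gram i u k m); last first.
  by rewrite christoffel_lower//; ring.
by rewrite mulr_sumr mulr_suml; apply: eq_bigr => k _; ring.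
Qed.

(** Lowering the index turns the two Christoffel terms into sums of first
  derivatives of the Gram matrix. By symmetry all of them cancel but the
  derivative in the direction [p], each half of which comes from one term. *)
Lemma christoffel_form_compatible i x p v w : dom i x ->
  let u := coord i x in
  (christoffel_form i u p v *m gram i u *m w^T) 0 0 +
  (christoffel_form i u p w *m gram i u *m v^T) 0 0 =
  \sum_m \sum_b v 0 b * (\sum_a p 0 a * dgram i u a b m) * w 0 m.
Proof.
move=> ix u; rewrite !christoffel_form_gram//.
under [X in X + _ = _]eq_bigr do rewrite exchange_big/=.
under [X in _ + X = _]eq_bigr do rewrite exchange_big/=.
rewrite [X in _ + X = _]exchange_big/= -big_split/=; apply: eq_bigr => m _.
rewrite -big_split; apply: eq_bigr => b _ /=.
rewrite -big_split mulr_sumr mulr_suml; apply: eq_bigr => a _ /=.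
rewrite -/u (dgram_sym a m b ix) (dgram_sym b m a ix) (dgram_sym m b a ix) -/u.
by field.
Qed.

(** For parallel fields the derivative of the inner product is the sum of the two
  Christoffel terms and of the derivative of the metric, which cancel by
  [christoffel_form_compatible]. *)
Lemma is_derive_gram_form i gam (t : R) p (V W : R -> 'rV[R]_n) :
  dom i (gam t) ->
  is_derive t 1 (coord i \o gam) p ->
  is_derive t 1 V (- christoffel_form i (coord i (gam t)) p (V t)) ->
  is_derive t 1 W (- christoffel_form i (coord i (gam t)) p (W t)) ->
  is_derive t 1
    (fun s => (V s *m gram i (coord i (gam s)) *m (W s)^T) 0 0) 0.
Proof.
move=> it dc dV dW.
pose u := coord i (gam t).
pose dG a b := \sum_c p 0 c * dgram i u c a b.
have hG a b : is_derive t 1 (fun s => gram i (coord i (gam s)) a b) (dG a b).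
  have := is_derive_diff_comp dc (gram_differentiable a b it).
  by rewrite diff_basis//; exact: gram_differentiable.
have -> : (fun s => (V s *m gram i (coord i (gam s)) *m (W s)^T) 0 0) =
   (fun s => \sum_b (\sum_a V s 0 a * gram i (coord i (gam s)) a b) * W s 0 b).
  by apply/funext => s; exact: gram_formE.
have h : is_derive t 1
   (fun s => \sum_b (\sum_a V s 0 a * gram i (coord i (gam s)) a b) * W s 0 b)
   (\sum_b ((\sum_a ((- christoffel_form i u p (V t)) 0 a * gram i u a b +
                      V t 0 a * dG a b)) * W t 0 b +
            (\sum_a V t 0 a * gram i u a b) *
             (- christoffel_form i u p (W t)) 0 b)).
  apply: is_derive_bigsum => b.
  apply: is_derive_mul (is_derive_entry b dW).
  by apply: is_derive_bigsum => a; exact: is_derive_mul (is_derive_entry a dV) (hG a b).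
apply: is_derive_eq h _.
transitivity (- (christoffel_form i u p (V t) *m gram i u *m (W t)^T) 0 0
   - (christoffel_form i u p (W t) *m gram i u *m (V t)^T) 0 0
   + \sum_m \sum_b V t 0 b * dG b m * W t 0 m); last first.
  by rewrite -opprD christoffel_form_compatible// addNr.
have -> : (christoffel_form i u p (W t) *m gram i u *m (V t)^T) 0 0 =
    \sum_b (\sum_a V t 0 a * gram i u a b) * christoffel_form i u p (W t) 0 b.
  rewrite gram_formE; under [LHS]eq_bigr do rewrite mulr_suml.
  rewrite exchange_big; apply: eq_bigr => b _ /=.
  rewrite mulr_suml; apply: eq_bigr => a _.
  by rewrite (gram_entry_sym _ _ it); ring.
rewrite gram_formE -!sumrN -!big_split; apply: eq_bigr => b _ /=.
rewrite big_split/= mulrDl mxE mulrN addrAC; congr (_ - _); congr (_ + _).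
  by rewrite -mulNr -sumrN; congr (_ * _); apply: eq_bigr => a _; rewrite mxE mulNr.
by rewrite mulr_suml.
Qed.

End connection.

(** * Parallel fields and geodesics *)

Section geodesics.
Context {R : realType} {n : nat} {M : riemannian R n}.
Implicit Types (x y : M) (i j : chart M) (u v w p : 'rV[R]_n) (gam : R -> M).

Lemma near_around (e t : R) : - e < t < 1 + e ->
  \forall s \near t, - e < s < 1 + e.
Proof.
move=> /andP[et te]; near=> s; apply/andP; split.
  by near: s; exact: lt_nbhsr.
by near: s; exact: lt_nbhsl.
Unshelve. all: by end_near. Qed.

Lemma mem01_around (e t : R) : 0 < e -> 0 <= t <= 1 -> - e < t < 1 + e.
Proof. by move=> e0 /andP[t0 t1]; apply/andP; split; lra. Qed.

Definition derivable_curve gam := around01 (fun t => {for t, continuous gam} /\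
  forall i, dom i (gam t) -> derivable (coord i \o gam) t 1).

Lemma geodesic_derivable_curve gam : is_geodesic gam -> derivable_curve gam.
Proof.
move=> [e e0 h]; exists e; first exact: e0.
move=> t /h[gt ht]; split; first exact: gt.
by move=> i it; have [] := ht i it.
Qed.

Lemma near_in_dom i gam (t : R) : dom i (gam t) -> {for t, continuous gam} ->
  \forall s \near t, dom i (gam s).
Proof. by move=> it gt; exact: (gt _ (near_dom it)). Qed.

Lemma near_in_chart_velocity e i gam t :
  (forall t : R, - e < t < 1 + e -> {for t, continuous gam} /\
    forall i, dom i (gam t) -> derivable (coord i \o gam) t 1) ->
  - e < t < 1 + e -> dom i (gam t) ->
  \forall s \near t,
    derive1 (coord i \o gam) s = in_chart i (gam s) (velocity gam s).
Proof.
move=> h et it; have [gt _] := h t et.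
near=> s.
have is_ : dom i (gam s) by near: s; exact: near_in_dom.
have es : - e < s < 1 + e by near: s; exact: near_around.
have [gs /(_ i is_) ds] := h s es.
by rewrite (in_chart_velocity is_ gs (is_derive1P ds)).
Unshelve. all: by end_near. Qed.

(** In every chart the geodesic equation is the equation of parallel transport of
  the velocity. *)
Lemma geodesic_parallel gam : is_geodesic gam -> is_parallel gam (velocity gam).
Proof.
move=> hg; have [e e0 h] := hg; exists e => // t et i it c W.
have hW : \forall s \near t, derive1 c s = W s.
  apply: (near_in_chart_velocity _ et it) => s /h[gs hs]; split=> // j js.
  by have [] := hs j js.
have [_ /(_ i it)[_ d2 d3]] := h t et.
have hWt : derive1 c t = W t := nbhs_singleton hW.
have dW : derive1 (derive1 c) t = derive1 W t := near_eq_derive1 hW.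
split; first exact: near_eq_derivable hW d2.
by rewrite -dW -hWt; exact: d3.
Qed.

Lemma derive0_cst01 (h : R -> R) :
  (forall t : R, 0 <= t <= 1 -> is_derive t 1 h 0) ->
  forall t : R, 0 <= t <= 1 -> h t = h 0.
Proof.
move=> hd t /andP[t0 t1].
have hc : {within `[0, 1], continuous h}.
  by apply: derivable_within_continuous => s; rewrite in_itv/= => /hd[].
have hd' (s : R) : s \in `]0, 1[%R -> is_derive s 1 h 0.
  by rewrite in_itv/= => /andP[s0 s1]; apply: hd; rewrite !ltW.
apply/eqP; rewrite eq_le; apply/andP; split.
- apply: (@ler0_derive1_nincr _ h 0 1) => // s /hd' hs; first by case: hs.
  by rewrite (is_derive1E hs).
- apply: (@ger0_derive1_ndecr _ h 0 1) => // s /hd' hs; first by case: hs.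
  by rewrite (is_derive1E hs).
Qed.

(** The inner product does not depend on the chart, so its derivative may be
  computed in a chart around each time, where it vanishes. *)
Lemma parallel_inner_cst gam V W : derivable_curve gam ->
  is_parallel gam V -> is_parallel gam W ->
  forall t, 0 <= t <= 1 ->
    inner (gam t) (V t) (W t) = inner (gam 0) (V 0) (W 0).
Proof.
move=> [e e0 hg] [e1 e10 hV] [e2 e20 hW].
apply: derive0_cst01 => t t01.
have [gt hgt] := hg t (mem01_around e0 t01).
pose i := chart_at (gam t); have it : dom i (gam t) := mem_chart_at _.
have [V1 V2] := hV t (mem01_around e10 t01) i it.
have [W1 W2] := hW t (mem01_around e20 t01) i it.
have near_inner : \forall s \near t,
  (in_chart i (gam s) (V s) *m gram i (coord i (gam s)) *m
     (in_chart i (gam s) (W s))^T) 0 0 = inner (gam s) (V s) (W s).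
  apply: filterS (near_in_dom it gt) => s is_.
  by rewrite (inner_in_chart _ _ is_).
apply: (near_eq_is_derive near_inner).
have dV := is_derive1P V1; rewrite V2 in dV.
have dW := is_derive1P W1; rewrite W2 in dW.
exact: is_derive_gram_form it (is_derive1P (hgt i it)) dV dW.
Qed.

Lemma geodesic_speed gam t : is_geodesic gam -> 0 <= t <= 1 ->
  tnorm (gam t) (velocity gam t) = tnorm (gam 0) (velocity gam 0).
Proof.
move=> hg t01; have hp := geodesic_parallel hg; rewrite /tnorm.
by rewrite (parallel_inner_cst (geodesic_derivable_curve hg) hp hp t01).
Qed.

Lemma geodesic_C1_arc gam : is_geodesic gam -> C1_arc gam.
Proof.
move=> [e e0 h]; exists e; first exact: e0.
move=> t /h[gt ht]; split; first exact: gt.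
move=> i it c; have [d1 d2 _] := ht i it; split; first exact: d1.
by apply: differentiable_continuous; exact/derivable1_diffP.
Qed.

Lemma arc_length_geodesic gam : is_geodesic gam ->
  arc_length gam = tnorm (gam 0) (velocity gam 0).
Proof.
move=> hg; rewrite /arc_length.
under eq_Rintegral => t.
  rewrite inE/= in_itv/= => t01; rewrite (geodesic_speed hg t01).
  over.
rewrite /Rintegral integral_cst//= lebesgue_measure_itv/= lte_fin ltr01.
by rewrite oppr0 -EFinD addr0 mule1.
Qed.

Definition subarc (a b : R) gam : R -> M := fun s => gam (a + b * s).

Lemma is_derive_affine (V : normedModType R) (f : R -> V) (a b s : R) df :
  is_derive (a + b * s) 1 f df ->
  is_derive s 1 (fun s => f (a + b * s)) (b *: df).
Proof.
move=> hf.
have h : is_derive s 1 (fun s : R => a + b * s) b.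
  have := is_deriveD (is_derive_cst a s 1) (is_deriveZ b (is_derive_id s (1 : R))).
  by rewrite add0r /GRing.scale/= mulr1.
have [/derivable1_diffP hd <-] := hf.
have hb : 'd f (a + b * s) b = b *: 'D_1 f (a + b * s).
  rewrite deriveE//; transitivity ('d f (a + b * s) (b *: (1 : R))).
    by congr ('d f _ _); rewrite /GRing.scale/= mulr1.
  by rewrite [LHS]linearZ.
by rewrite -hb; exact: is_derive_diff_comp h hd.
Qed.

End geodesics.

(** * Distance, logarithm and descent along geodesics *)

Section subarcs.
Context {R : realType} {n : nat} {M : riemannian R n}.
Implicit Types (x y : M) (i j : chart M) (u v w p : 'rV[R]_n) (gam : R -> M).

Lemma christoffel_formZ i u (b : R) v w :
  christoffel_form i u (b *: v) (b *: w) = b *: (b *: christoffel_form i u v w).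
Proof.
apply/rowP => k; rewrite !mxE !mulr_sumr; apply: eq_bigr => a _.
by rewrite !mulr_sumr; apply: eq_bigr => c _; rewrite !mxE; ring.
Qed.

Lemma subarc_around (e a b s : R) : 0 <= a -> 0 <= b -> a + b <= 1 -> 0 < e ->
  - e < s < 1 + e -> - e < a + b * s < 1 + e.
Proof.
move=> a0 b0 ab e0 /andP[es se].
have h1 : b * (s + e) >= 0 by apply: mulr_ge0 => //; lra.
have h2 : b * (1 + e - s) >= 0 by apply: mulr_ge0 => //; lra.
(* For b = 1 both inequalities are those on s; otherwise there is some room. *)
have [b1|b1] := ltP b 1.
  have h3 : (1 - b) * e > 0 by apply: mulr_gt0 => //; lra.
  by apply/andP; split; lra.
have -> : b = 1 by lra.
have -> : a = 0 by lra.
by apply/andP; split; lra.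
Qed.

Lemma continuous_subarc a b gam (s : R) : {for a + b * s, continuous gam} ->
  {for s, continuous (subarc a b gam)}.
Proof.
move=> h; apply: (@continuous_comp _ _ _ (fun s : R => a + b * s) gam); last exact: h.
apply: differentiable_continuous; apply/derivable1_diffP.
by case: (@is_derive_affine _ R id a b s 1 (is_derive_id _ _)).
Qed.

(** Both sides of the geodesic equation are quadratic in the speed [b]. *)
Lemma subarc_geodesic a b gam : 0 <= a -> 0 <= b -> a + b <= 1 ->
  is_geodesic gam -> is_geodesic (subarc a b gam).
Proof.
move=> a0 b0 ab [e e0 h]; exists e; first exact: e0.
move=> s es; have es' := subarc_around a0 b0 ab e0 es.
have [gs hs] := h _ es'.
have cs := continuous_subarc gs; split; first exact: cs.
move=> i is_ c.
pose c0 := coord i \o gam.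
have [d1 d2 d3] := hs i is_.
have dc : is_derive s 1 c (b *: derive1 c0 (a + b * s)).
  exact: is_derive_affine (is_derive1P d1).
have hc : \forall r \near s, b *: derive1 c0 (a + b * r) = derive1 c r.
  near=> r.
  have ir : dom i (subarc a b gam r) by near: r; exact: (cs _ (near_dom is_)).
  have er : - e < r < 1 + e by near: r; exact: near_around.
  have [gr /(_ i ir)[dr _ _]] := h _ (subarc_around a0 b0 ab e0 er).
  by rewrite (is_derive1E (is_derive_affine (is_derive1P dr))).
have d2c : is_derive s 1 (derive1 c) (b *: (b *: derive1 (derive1 c0) (a + b * s))).
  exact: near_eq_is_derive hc
    (is_derive_affine (f := b \*: derive1 c0) (is_deriveZ b (is_derive1P d2))).
have [dc1 _] := dc; have [d2c1 _] := d2c.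
split; [exact: dc1|exact: d2c1|].
rewrite (is_derive1E d2c) (is_derive1E dc) d3 christoffel_formZ.
rewrite !scalerN; reflexivity.
Unshelve. all: by end_near. Qed.

Lemma velocity_subarc a b gam (s : R) : 0 <= a -> 0 <= b -> a + b <= 1 ->
  is_geodesic gam -> 0 <= s <= 1 ->
  velocity (subarc a b gam) s = b *: velocity gam (a + b * s).
Proof.
move=> a0 b0 ab [e e0 h] s01.
have es' := subarc_around a0 b0 ab e0 (mem01_around e0 s01).
have [gs hs] := h _ es'; have [d1 _ _] := hs _ (mem_chart_at _).
by rewrite /velocity (is_derive1E (is_derive_affine (is_derive1P d1))).
Qed.

Lemma pw_curve_trans x y z l l' :
  @pw_curve R n M x y l -> pw_curve y z l' -> pw_curve x z (l + l').
Proof.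
elim=> [{}x|gam {}y {}l hg _ IH] hz; first by rewrite add0r.
by rewrite -addrA; apply: pw_cons => //; exact: IH.
Qed.

Lemma pw_curve_arc gam : C1_arc gam -> pw_curve (gam 0) (gam 1) (arc_length gam).
Proof. by move=> hg; rewrite -[arc_length _]addr0; exact: pw_cons hg (pw_nil _). Qed.

Lemma dist_le_length x y l : pw_curve x y l -> (dist x y <= l%:E)%E.
Proof. by move=> h; apply: ereal_inf_lbound; exists l. Qed.

Lemma pw_curve_geodesic gam : is_geodesic gam ->
  pw_curve (gam 0) (gam 1) (tnorm (gam 0) (velocity gam 0)).
Proof.
move=> hg; rewrite -arc_length_geodesic//; apply: pw_curve_arc.
exact: geodesic_C1_arc.
Qed.

Lemma pw_curve_subgeodesic a b gam : 0 <= a -> 0 <= b -> a + b <= 1 ->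
  is_geodesic gam ->
  pw_curve (gam a) (gam (a + b)) (b * tnorm (gam 0) (velocity gam 0)).
Proof.
move=> a0 b0 ab hg.
have e0 : subarc a b gam 0 = gam a by rewrite /subarc mulr0 addr0.
have e1 : subarc a b gam 1 = gam (a + b) by rewrite /subarc mulr1.
have s0 : 0 <= (0 : R) <= 1 by apply/andP; split; lra.
have ev := velocity_subarc a0 b0 ab hg s0; rewrite mulr0 addr0 in ev.
have a01 : 0 <= a <= 1 by apply/andP; split; lra.
have := pw_curve_geodesic (subarc_geodesic a0 b0 ab hg).
rewrite e0 e1.
rewrite ev.
rewrite tnormZ; last exact: b0.
rewrite (geodesic_speed hg a01).
exact: id.
Qed.

Lemma LogP x y : log_defined x y -> is_log x y (Log x y).
Proof. by move=> [v [hv _]]; apply: xgetPex; exists v. Qed.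

Lemma Log_unique x y v : log_defined x y -> is_log x y v -> Log x y = v.
Proof.
move=> h hv; have := LogP h; case: h => v0 [_ hu] hl.
by rewrite -(hu _ hv) -(hu _ hl).
Qed.

Lemma tnorm_Log x y : log_defined x y -> (tnorm x (Log x y))%:E = dist x y.
Proof. by move=> /LogP[]. Qed.

Lemma subarc_start t gam : subarc 0 t gam 0 = gam 0.
Proof. by rewrite /subarc mulr0 addr0. Qed.

Lemma subarc_end t gam : subarc 0 t gam 1 = gam t.
Proof. by rewrite /subarc mulr1 add0r. Qed.

Lemma initial_subarc t gam : 0 <= t <= 1 -> is_geodesic gam ->
  [/\ is_geodesic (subarc 0 t gam),
      velocity (subarc 0 t gam) 0 = t *: velocity gam 0 &
      velocity (subarc 0 t gam) 1 = t *: velocity gam t].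
Proof.
move=> /andP[t0 t1] hg; have t01 : 0 + t <= 1 by rewrite add0r.
have s0 : 0 <= (0 : R) <= 1 by apply/andP; split; lra.
have s1 : 0 <= (1 : R) <= 1 by apply/andP; split; lra.
have v0 := velocity_subarc (lexx 0) t0 t01 hg s0.
have v1 := velocity_subarc (lexx 0) t0 t01 hg s1.
rewrite mulr0 addr0 in v0; rewrite mulr1 add0r in v1.
split; [exact: subarc_geodesic|exact: v0|exact: v1].
Qed.

(** A geodesic that realizes the distance between its end points also realizes
  the distance from its origin to each of its points, since the remaining piece
  and any shortcut would add up to a shorter curve. *)
Lemma Log_geodesic x y gam (t : R) : log_defined x y -> geodesic_to x y gam ->
  0 <= t <= 1 -> log_defined x (gam t) -> Log x (gam t) = t *: Log x y.
Proof.
move=> hxy [hg g0 g1 gv] /andP[t0 t1] hxt; apply: Log_unique => //.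
have t01 : 0 + t <= 1 by rewrite add0r.
have [sg sv0 _] := initial_subarc (introT andP (conj t0 t1)) hg.
split.
  exists (subarc 0 t gam); split.
  - exact: sg.
  - by rewrite subarc_start.
  - by rewrite sv0 gv.
  - exact: subarc_end.
rewrite tnormZ//; apply/eqP; rewrite eq_le; apply/andP; split.
  apply: le_ereal_inf_tmp => _ [l hl <-]; rewrite lee_fin.
  have tt1 : t + (1 - t) <= 1 by lra.
  have t1' : 0 <= 1 - t by lra.
  have := pw_curve_subgeodesic t0 t1' tt1 hg.
  rewrite [t + (1 - t)]addrC subrK g1 g0 gv => hl2.
  have := dist_le_length (pw_curve_trans hl hl2).
  rewrite -tnorm_Log// lee_fin; lra.
apply: dist_le_length; have := pw_curve_subgeodesic (lexx 0) t0 t01 hg.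
by rewrite add0r g0 gv.
Qed.

(** Chain rule: the gradient represents the differential in the preferred chart
  of the current point. *)
Lemma is_derive_along f gam (t : R) : mdifferentiable f (gam t) ->
  {for t, continuous gam} ->
  (forall i, dom i (gam t) -> derivable (coord i \o gam) t 1) ->
  is_derive t 1 (f \o gam) (inner (gam t) (grad f (gam t)) (velocity gam t)).
Proof.
move=> df gt hd; rewrite inner_grad//.
pose j := chart_at (gam t); have jt : dom j (gam t) := mem_chart_at _.
have E : \forall s \near t,
    ((f \o point_of j) \o (coord j \o gam)) s = (f \o gam) s.
  by apply: filterS (near_in_dom jt gt) => s js /=; rewrite coordK.
apply: (near_eq_is_derive E).
exact: is_derive_diff_comp (is_derive1P (hd j jt)) df.
Qed.

(** Along the geodesic, parallel transport keeps the inner product of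
  [grad f x] with the velocity constant, so that smoothness bounds the
  derivative of [f] by its initial value plus a term linear in time. *)
Lemma descent (L : R) f (X : set M) x y gam (eta : R) :
  (forall x y, X x -> X y -> log_defined x y) -> geodesically_convex X ->
  L_smooth L f -> X x -> X y -> geodesic_to x y gam -> 0 <= eta <= 1 ->
  f (gam eta) <= f x + eta * inner x (grad f x) (Log x y) +
                 L / 2 * eta ^+ 2 * tnorm x (Log x y) ^+ 2.
Proof.
move=> X_log X_convex [fd fL] Xx Xy hgto eta01.
have hg := hgto; case: hg => hg g0 g1 gv.
have [e e0 hd] := geodesic_derivable_curve hg.
set a := inner x (grad f x) (Log x y); set V := tnorm x (Log x y).
pose h t : R := f (gam t) - (a * t + L / 2 * V ^+ 2 * (t * t)).
pose dh t : R := inner (gam t) (grad f (gam t)) (velocity gam t) -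
  (a * 1 + L / 2 * V ^+ 2 * (1 * t + t * 1)).
have hdh (t : R) : 0 <= t <= 1 -> is_derive t 1 h (dh t).
  move=> /(mem01_around e0)/hd[gt ht].
  have d1 := is_derive_along (fd _) gt ht.
  have d2 := is_deriveZ a (is_derive_id t (1 : R)).
  have d3 := is_deriveZ (L / 2 * V ^+ 2)
    (is_derive_mul (is_derive_id t (1 : R)) (is_derive_id t (1 : R))).
  exact: (is_deriveB d1 (is_deriveD d2 d3)).
have hc : {within `[0, 1], continuous h}.
  by apply: derivable_within_continuous => s; rewrite in_itv/= => /hdh[].
have hle (t : R) : 0 < t < 1 -> dh t <= 0.
  move=> /andP[t0 t1].
  have t01 : 0 <= t <= 1 by rewrite !ltW.
  have hx : log_defined x (gam t) by exact: X_log Xx (X_convex _ _ _ Xx Xy hgto _ t01).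
  have [sg sv0 sv1] := initial_subarc t01 hg.
  have sto : geodesic_to x (gam t) (subarc 0 t gam).
    split; [exact: sg|by rewrite subarc_start|exact: subarc_end|].
    by rewrite sv0 gv (Log_geodesic (X_log _ _ Xx Xy) hgto t01 hx).
  have [w [U [Upar U0 U1]]] := fL _ _ _ hx sto.
  rewrite -tnorm_Log// (Log_geodesic (X_log _ _ Xx Xy) hgto t01 hx) lee_fin.
  rewrite tnormZ; last exact: ltW.
  rewrite -/V => hw.
  have l01 : 0 <= (1 : R) <= 1 by rewrite ler01 lexx.
  have := parallel_inner_cst (geodesic_derivable_curve sg) Upar
    (geodesic_parallel sg) l01.
  rewrite subarc_end subarc_start U1 U0 sv0 sv1 g0 gv !innerZr -/a.
  move=> /(mulfI (lt0r_neq0 t0)) wa.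
  have hV : tnorm (gam t) (velocity gam t) = V.
    by rewrite geodesic_speed// g0 gv.
  have := inner_le_tnorm (gam t) (grad f (gam t) - w) (velocity gam t).
  rewrite innerDl innerNl wa hV /dh => h1.
  have h2 : tnorm (gam t) (grad f (gam t) - w) * V <= L * (t * V) * V.
    by apply: ler_wpM2r => //; exact: tnorm_ge0.
  lra.
have /andP[eta0 eta1] := eta01.
have hder (s : R) : s \in `]0, 1[%R -> is_derive s 1 h (dh s) /\ dh s <= 0.
  rewrite in_itv/= => s01; split; last exact: hle.
  by have /andP[s0 s1] := s01; apply: hdh; rewrite !ltW.
have : h eta <= h 0.
  apply: (@ler0_derive1_nincr _ h 0 1 _ _ hc) => // s /hder[hs hs0].
    by case: hs.
  by rewrite (is_derive1E hs).
rewrite /h g0; lra.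
Qed.

End subarcs.

(** * Distances in a compact set are bounded *)

Section monotone_integral.
Local Open Scope ereal_scope.
Context d (T : measurableType d) (R : realType).
Variable mu : {measure set T -> \bar R}.

(** The integral of a nonnegative function is a supremum over the simple
  functions below it, hence monotone without any measurability. *)
Lemma ge0_le_integral_nonmeas (D : set T) (f g : T -> \bar R) :
  (forall x, D x -> 0 <= f x) -> (forall x, D x -> f x <= g x) ->
  \int[mu]_(x in D) f x <= \int[mu]_(x in D) g x.
Proof.
move=> f0 fg; rewrite !(integral_mkcond D).
have h10 x : 0 <= (f \_ D) x by apply: erestrict_ge0.
have h12 x : (f \_ D) x <= (g \_ D) x by apply: lee_restrict.
have h20 x : 0 <= (g \_ D) x by exact: le_trans (h12 x).
rewrite !ge0_integralTE//; apply: ereal_sup_le => _ [h hf <-].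
by exists h => // x; exact: le_trans (hf x) (h12 x).
Qed.

End monotone_integral.

Section segments.
Context {R : realType} {n : nat} {M : riemannian R n}.
Implicit Types (x y : M) (i j : chart M) (u v w p h : 'rV[R]_n) (gam : R -> M).

Lemma row_entry_le_norm v a : `|v 0 a| <= `|v|.
Proof.
rewrite [leRHS]mx_normrE.
exact: (le_bigmax _ (fun ij => `|v ij.1 ij.2|) (ord0, a)).
Qed.

Definition chart_line i u h : R -> M := fun t => point_of i (u + t *: h).

Lemma is_derive_line u h (t : R) : is_derive t 1 (fun t : R => u + t *: h) h.
Proof.
have d1 : is_derive t 1 (fun t : R => t *: h) h.
  have dt : differentiable (fun t : R => t *: h) t.
    by apply: differentiableZl; exact/derivable1_diffP/derivable_id.
  apply: DeriveDef; first exact/derivable1_diffP.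
  rewrite deriveE// diffZl; last exact/derivable1_diffP/derivable_id.
  have [_ E] := is_derive_id t (1 : R).
  rewrite -deriveE ?E ?scale1r//; exact/derivable1_diffP/derivable_id.
have := is_deriveD (is_derive_cst u t 1) d1.
by rewrite add0r.
Qed.

Lemma continuous_chart_line i u h (t : R) : (coord i @` dom i) (u + t *: h) ->
  {for t, continuous (chart_line i u h)}.
Proof.
move=> [x ix xE].
apply: (@continuous_comp _ _ _ (fun t : R => u + t *: h) (point_of i)).
  apply: differentiable_continuous; apply/derivable1_diffP.
  by have [] := is_derive_line u h t.
by rewrite -xE; exact: point_of_continuous.
Qed.

Lemma near_line_img i u h (t : R) : (coord i @` dom i) (u + t *: h) ->
  \forall s \near t, (coord i @` dom i) (u + s *: h).
Proof.
move=> it; have : {for t, continuous (fun t : R => u + t *: h)}.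
  apply: differentiable_continuous; apply/derivable1_diffP.
  by have [] := is_derive_line u h t.
apply; apply: open_nbhs_nbhs; split; first exact: img_open.
exact: it.
Qed.

Lemma is_derive_chart_line i j u h (t : R) : (coord i @` dom i) (u + t *: h) ->
  dom j (chart_line i u h t) ->
  is_derive t 1 (coord j \o chart_line i u h)
    ('d (transition i j) (u + t *: h) h).
Proof.
move=> [x ix xE]; rewrite /chart_line -xE coordK// => jx.
have := is_derive_diff_comp (is_derive_line u h t).
by move=> /(_ _ (transition i j)); rewrite -xE; apply; exact: transition_differentiable.
Qed.

Lemma chart_line_velocity i u h (t : R) : (coord i @` dom i) (u + t *: h) ->
  in_chart i (chart_line i u h t) (velocity (chart_line i u h) t) = h.
Proof.
move=> it; have [x ix xE] := it.
have ix' : dom i (chart_line i u h t) by rewrite /chart_line -xE coordK.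
apply: in_chart_velocity ix' (continuous_chart_line it) _.
have E : \forall s \near t, u + s *: h = (coord i \o chart_line i u h) s.
  by apply: filterS (near_line_img it) => s [y iy yE] /=; rewrite /chart_line -yE coordK.
exact: near_eq_is_derive E (is_derive_line u h t).
Qed.

Lemma partial_transition_differentiable i j a b x : dom i x -> dom j x ->
  differentiable ('D_(delta_mx 0 a) (fun u => transition i j u 0 b)) (coord i x).
Proof.
move=> ix jx; have [_ /(_ a)[+ _]] := @transition_smooth _ _ M i j b 2.
by apply; exists x.
Qed.

(** In another chart the velocity of a straight segment is a combination of first
  derivatives of the transition map, which are themselves differentiable. *)
Lemma chart_line_derive1_continuous i j u h (t : R) :
  (coord i @` dom i) (u + t *: h) -> dom j (chart_line i u h t) ->
  {for t, continuous (derive1 (coord j \o chart_line i u h))}.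
Proof.
move=> it jt; have [x ix xE] := it.
have jx : dom j x by move: jt; rewrite /chart_line -xE coordK.
pose g b s := \sum_a h 0 a * 'D_(delta_mx 0 a) (fun u => transition i j u 0 b) (u + s *: h).
have dg b : differentiable (g b) t.
  apply/derivable1_diffP.
  have dF a : differentiable ('D_(delta_mx 0 a) (fun u => transition i j u 0 b))
      (u + t *: h).
    by rewrite -xE; exact: partial_transition_differentiable.
  have hd a := is_derive_diff_comp (is_derive_line u h t) (dF a).
  by have [] := is_derive_bigsum (fun a => is_deriveZ (h 0 a) (hd a)).
have E : \forall s \near t, \row_b g b s = derive1 (coord j \o chart_line i u h) s.
  near=> s.
  have is_ : (coord i @` dom i) (u + s *: h) by near: s; exact: near_line_img.
  have js : dom j (chart_line i u h s).
    by near: s; exact: (continuous_chart_line it (near_dom jt)).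
  rewrite (is_derive1E (is_derive_chart_line is_ js)).
  have [y iy yE] := is_.
  have jy : dom j y by move: js; rewrite /chart_line -yE coordK.
  have dtr : differentiable (transition i j) (u + s *: h).
    by rewrite -yE; exact: transition_differentiable.
  apply/rowP => b; rewrite mxE diff_row_entry// diff_basis//.
  apply: (@differentiable_comp _ _ _ _ (transition i j) (fun N : 'rV[R]_n => N 0 b : R)) => //.
  exact: differentiable_coord.
apply: differentiable_continuous.
apply: (near_eq_differentiable E); apply: differentiable_row => b.
by under eq_fun do rewrite mxE; exact: dg.
Unshelve. all: by end_near. Qed.

Lemma chart_line_C1_arc i u h (e : R) : 0 < e ->
  (forall t, - e < t < 1 + e -> (coord i @` dom i) (u + t *: h)) ->
  C1_arc (chart_line i u h).
Proof.
move=> e0 hi; exists e; first exact: e0.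
move=> t /hi it; split; first exact: continuous_chart_line.
move=> j jt c; split; last exact: chart_line_derive1_continuous.
by have [] := is_derive_chart_line it jt.
Qed.

(** The bound on the speed is integrated without measurability of the speed. *)
Lemma arc_length_le gam (B : R) : (forall t, 0 <= t <= 1 ->
  tnorm (gam t) (velocity gam t) <= B) -> arc_length gam <= B.
Proof.
move=> hB; rewrite /arc_length /Rintegral.
set I := (\int[_]_(_ in _) _)%E.
have I0 : (0 <= I)%E by apply: integral_ge0 => t _; rewrite lee_fin tnorm_ge0.
have IB : (I <= B%:E)%E.
  have -> : B%:E = (\int[lebesgue_measure]_(t in `[0%R, 1%R]%classic) (cst B%:E) t)%E.
    rewrite integral_cst//= lebesgue_measure_itv/= lte_fin ltr01.
    by rewrite oppr0 -EFinD addr0 mule1.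
  apply: ge0_le_integral_nonmeas => t; first by rewrite lee_fin tnorm_ge0.
  by rewrite /= in_itv/= lee_fin => /hB.
rewrite -lee_fin fineK// ge0_fin_numE//.
exact: le_lt_trans IB (ltry _).
Qed.

Lemma gram_locally_bounded i x : dom i x -> exists B : R,
  0 <= B /\ \forall u \near coord i x, forall a b, `|gram i u a b| <= B.
Proof.
move=> ix; pose B := 1 + \sum_a \sum_b `|gram i (coord i x) a b|.
have B0 : 0 <= B by rewrite addr_ge0// sumr_ge0// => a _; rewrite sumr_ge0.
exists B; split=> //.
suff hB a b : \forall u \near coord i x, `|gram i u a b| <= B.
  have h a := @filter_forall _ _ (fun b u => `|gram i u a b| <= B) _ _ (hB a).
  exact: (@filter_forall _ _ (fun a u => forall b, `|gram i u a b| <= B) _ _ (h _)).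
have gc := differentiable_continuous (gram_differentiable a b ix).
have /cvgrPdist_lt/(_ 1 ltr01) := gc; apply: filterS => u hu.
rewrite -[gram i u a b](subKr (gram i (coord i x) a b)).
apply: le_trans (ler_normB _ _) _; rewrite addrC /B; apply: lerD; first exact: ltW.
rewrite (bigD1 a)//= ler_wpDr//; first by rewrite sumr_ge0// => c _; rewrite sumr_ge0.
by rewrite (bigD1 b)//= ler_wpDr// sumr_ge0.
Qed.

(** On ]-1, 2[ both [1 - t] and [t] are at most 2 in absolute value. *)
Lemma near_convex_comb (V : normedModType R) (u0 u1 u2 : V) (r t : R) :
  `|u0 - u1| < r / 4 -> `|u0 - u2| < r / 4 -> -1 < t < 2 ->
  `|u0 - (u1 + t *: (u2 - u1))| < r.
Proof.
move=> h1 h2 /andP[t1 t2].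
have -> : u0 - (u1 + t *: (u2 - u1)) = (1 - t) *: (u0 - u1) + t *: (u0 - u2).
  rewrite scalerBl scale1r opprD addrA -[RHS]addrA; congr (_ + _).
  by rewrite -!scalerN -scalerDr !opprB addrA subrK.
apply: le_lt_trans (ler_normD _ _) _; rewrite !normrZ.
have a1 : `|1 - t| <= 2 by rewrite ler_norml; apply/andP; split; lra.
have a2 : `|t| <= 2 by rewrite ler_norml; apply/andP; split; lra.
have b1 : `|1 - t| * `|u0 - u1| <= 2 * `|u0 - u1| by rewrite ler_wpM2r.
have b2 : `|t| * `|u0 - u2| <= 2 * `|u0 - u2| by rewrite ler_wpM2r.
lra.
Qed.

(** Near [x] the straight segments of a chart have bounded length, because the
  metric is bounded there. *)
Lemma locally_bounded_pw_curve x : exists B : R, \forall y \near x,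
  (exists2 l, l <= B & pw_curve x y l) /\ (exists2 l, l <= B & pw_curve y x l).
Proof.
pose i := chart_at x; have ix : dom i x := mem_chart_at x.
have [Bg [Bg0 hBg]] := gram_locally_bounded ix.
have hI : \forall u \near coord i x, (coord i @` dom i) u /\
    forall a b, `|gram i u a b| <= Bg by exact: filterI (near_img ix) hBg.
have [r /= r0 hr] := (nbhs_ballP _ _).1 hI.
pose B := Num.sqrt (\sum_(b < n) (\sum_(a < n) r * Bg) * r).
have seg u1 u2 : `|coord i x - u1| < r / 4 -> `|coord i x - u2| < r / 4 ->
    exists2 l, l <= B & pw_curve (point_of i u1) (point_of i u2) l.
  move=> h1 h2; pose h := u2 - u1.
  have hin (t : R) : -1 < t < 2 -> (coord i @` dom i) (u1 + t *: h) /\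
      forall a b, `|gram i (u1 + t *: h) a b| <= Bg.
    by move=> t12; apply: hr; rewrite -ball_normE; exact: near_convex_comb.
  have c1 : C1_arc (chart_line i u1 h).
    apply: (chart_line_C1_arc ltr01) => t /andP[t1 t2].
    by have [] := hin t; first by apply/andP; split; lra.
  have := pw_curve_arc c1.
  rewrite /chart_line scale0r addr0 scale1r /h [u1 + _]addrC subrK => hc.
  exists (arc_length (chart_line i u1 h)); last exact: hc.
  apply: arc_length_le => t /andP[t0 t1].
  have [it hG] : (coord i @` dom i) (u1 + t *: h) /\
      forall a b, `|gram i (u1 + t *: h) a b| <= Bg.
    by apply: hin; apply/andP; split; lra.
  have [y iy yE] := it.
  have iy' : dom i (chart_line i u1 h t) by rewrite /chart_line -yE coordK.
  rewrite /tnorm (inner_in_chart _ _ iy') (chart_line_velocity it).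
  rewrite ler_wsqrtr// /chart_line -yE coordK// yE gram_formE.
  have hr' a : `|h 0 a| <= r.
    apply: le_trans (row_entry_le_norm _ _) _.
    have -> : h = (coord i x - u1) - (coord i x - u2).
      by rewrite opprB [RHS]addrC subrKA.
    apply: le_trans (ler_normB _ _) _; move: h1 h2; lra.
  apply: ler_sum => b _; apply: le_trans (ler_norm _) _; rewrite normrM.
  apply: ler_pM => //; apply: le_trans (ler_norm_sum _ _ _) _.
  by apply: ler_sum => a _; rewrite normrM; apply: ler_pM.
have r4 : 0 < r / 4 by rewrite divr_gt0.
have hnear : \forall y \near x, `|coord i x - coord i y| < r / 4.
  by have /cvgrPdist_lt/(_ _ r4) := coord_continuous ix.
exists B; near=> y.
have iy : dom i y by near: y; exact: near_dom.
have hy : `|coord i x - coord i y| < r / 4 by near: y; exact: hnear.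
have hx : `|coord i x - coord i x| < r / 4 by rewrite subrr normr0.
have := seg _ _ hx hy; have := seg _ _ hy hx; rewrite (coordK ix) (coordK iy).
by move=> s1 s2; split; [exact: s2|exact: s1].
Unshelve. all: by end_near. Qed.

(** A bound on the lengths of curves from and to [x0] extends to a neighbourhood
  of each point by [locally_bounded_pw_curve]. Compactness makes it uniform on
  [X], and curves through [x0] join any two points of [X]. *)
Lemma compact_dist_bounded (X : set M) x0 : compact X ->
  (forall x, X x -> dist x0 x \is a fin_num /\ dist x x0 \is a fin_num) ->
  exists D : R, forall x y, X x -> X y -> (dist x y <= D%:E)%E.
Proof.
move=> cX hfin.
pose P (D : R) (z : M) := (exists2 l, l <= D & pw_curve x0 z l) /\
                          (exists2 l, l <= D & pw_curve z x0 l).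
have fin_curve x y : dist x y \is a fin_num -> exists l, @pw_curve R n M x y l.
  move=> hf; have : (dist x y < +oo)%E by rewrite ltey_eq hf.
  by move=> /ereal_inf_lt[_ [l hl <-] _]; exists l.
have ncov : forall x, X x -> \forall x' \near x & D \near +oo, P D x'.
  move=> x Xx; have [/fin_curve[l1 hl1] /fin_curve[l2 hl2]] := hfin x Xx.
  have [B hB] := locally_bounded_pw_curve x.
  exists ([set y | (exists2 l, l <= B & pw_curve x y l) /\
                   (exists2 l, l <= B & pw_curve y x l)],
          [set D | Num.max (l1 + B) (l2 + B) <= D]).
    by split; [exact: hB|exact: (nbhs_pinfty_ge (num_real _))].
  move=> [y D] /= [[[l lB hl] [l' lB' hl']]]; rewrite ge_max => /andP[D1 D2].
  split.
    exists (l1 + l); last exact: pw_curve_trans hl1 hl.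
    by apply: le_trans D1; rewrite lerD2l.
  exists (l' + l2); last exact: pw_curve_trans hl' hl2.
  by apply: le_trans D2; rewrite addrC lerD2l.
have [A [_ hA]] := (compact_near_coveringP X).1 cX R _ P _ ncov.
have hD := hA (A + 1) (ltr_pwDr ltr01 (lexx A)).
exists ((A + 1) + (A + 1)) => x y Xx Xy.
have [_ [l lD hl]] := hD x Xx; have [[l' lD' hl'] _] := hD y Xy.
apply: le_trans (dist_le_length (pw_curve_trans hl hl')) _.
by rewrite lee_fin lerD.
Qed.

End segments.

(** * Joint measurability of gradients *)

Section chart_gradient.
Context {R : realType} {n : nat} {M : riemannian R n}.
Implicit Types (x y : M) (i j : chart M) (f g : M -> R).

Definition dchart i f x : 'rV[R]_n :=
  \row_a 'D_(delta_mx 0 a) (f \o point_of i) (coord i x).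

Lemma mdifferentiable_chart i f x : dom i x -> mdifferentiable f x ->
  differentiable (f \o point_of i) (coord i x).
Proof.
move=> ix df; pose j := chart_at x; have jx : dom j x := mem_chart_at x.
have E : \forall u \near coord i x,
    ((f \o point_of j) \o transition i j) u = (f \o point_of i) u.
  apply: filterS (near_point_of ix (near_dom jx)) => u ju.
  by rewrite /transition /= coordK.
apply: (near_eq_differentiable E); apply: differentiable_comp.
  exact: transition_differentiable.
by rewrite /transition /= (coordK ix); exact: df.
Qed.

Lemma inner_grad_chart i f x w : dom i x -> mdifferentiable f x ->
  inner x (grad f x) w = (dchart i f x *m (in_chart i x w)^T) 0 0.
Proof.
move=> ix df; rewrite inner_grad//.
pose j := chart_at x; have jx : dom j x := mem_chart_at x.
have E : \forall u \near coord j x,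
    ((f \o point_of i) \o transition j i) u = (f \o point_of j) u.
  apply: filterS (near_point_of jx (near_dom ix)) => u iu.
  by rewrite /transition /= coordK.
have dtr := transition_differentiable jx ix.
have trx : transition j i (coord j x) = coord i x by rewrite /transition /= coordK.
have dfi := mdifferentiable_chart ix df.
rewrite -deriveE; last exact: df.
rewrite -(near_eq_derive _ E) deriveE; last first.
  by apply: differentiable_comp; [exact: dtr|rewrite trx; exact: dfi].
rewrite diff_comp; [|exact: dtr|by rewrite trx; exact: dfi].
rewrite /= trx diff_basis; last exact: dfi.
rewrite [RHS]mxE; apply: eq_bigr => a _.
rewrite [X in _ = X * _]mxE [X in _ = _ * X]mxE mulrC.
by rewrite /in_chart mul_rV_lin1.
Qed.

(** The Jacobian is invertible because the two Gram matrices that it relates are. *)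
Lemma in_chart_surj i x h : dom i x -> exists w, in_chart i x w = h.
Proof.
move=> ix; have := gram_unit (mem_chart_at x).
rewrite (gram_change (mem_chart_at x) ix) !unitmx_mul => /andP[/andP[uJ _] _].
by exists (h *m invmx ('J (coord i \o point_of (chart_at x)) (coord (chart_at x) x)));
  rewrite /in_chart mulmxKV.
Qed.

Lemma in_chart_grad i f x : dom i x -> mdifferentiable f x ->
  in_chart i x (grad f x) = dchart i f x *m invmx (gram i (coord i x)).
Proof.
move=> ix df; have uG := gram_unit ix.
suff E : in_chart i x (grad f x) *m gram i (coord i x) = dchart i f x.
  by rewrite -E mulmxK.
apply/rowP => a; have [w wE] := in_chart_surj (delta_mx 0 a) ix.
have := inner_grad_chart w ix df; rewrite (inner_in_chart _ _ ix) wE.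
have entry (A : 'rV[R]_n) : (A *m (delta_mx 0 a : 'rV_n)^T) 0 0 = A 0 a.
  by rewrite trmx_delta -colE mxE.
by rewrite !entry.
Qed.

(** Gradients are row vectors in the preferred chart of each point, and the choice
  of this chart need not be measurable in the point; in a fixed chart their inner
  product becomes an expression with measurable ingredients. *)
Lemma inner_grad_grad i f g x : dom i x ->
  mdifferentiable f x -> mdifferentiable g x ->
  inner x (grad f x) (grad g x) =
  (dchart i f x *m invmx (gram i (coord i x)) *m (dchart i g x)^T) 0 0.
Proof.
move=> ix df dg; rewrite innerC (inner_grad_chart _ ix dg) in_chart_grad//.
have tr00 (A : 'M[R]_1) : A 0 0 = A^T 0 0 by rewrite mxE.
by rewrite tr00 trmx_mul trmxK.
Qed.

End chart_gradient.

Section measurable_matrix.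
Context {R : realType}.

Lemma measurable_inv d (T : measurableType d) (D : set T) (f : T -> R) :
  measurable D -> (forall x, D x -> f x != 0) -> measurable_fun D f ->
  measurable_fun D (fun x => (f x)^-1).
Proof.
move=> mD f0 mf.
have o0 : open [set r : R | r != 0] by exact: open_neq.
apply: (@measurable_comp _ _ _ _ _ _ [set r : R | r != 0] GRing.inv) => //.
- exact: open_measurable.
- by move=> _ [x Dx <-]; exact: f0.
apply: open_continuous_measurable_fun => // r; rewrite inE => r0.
by apply: differentiable_continuous; exact: differentiable_Rinv.
Qed.

Lemma measurable_det d (T : measurableType d) (D : set T) m (A : T -> 'M[R]_m) :
  (forall a b, measurable_fun D (fun x => A x a b)) ->
  measurable_fun D (fun x => \det (A x)).
Proof.
move=> mA; apply: measurable_sum => s; apply: measurable_funM => //.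
by apply: measurable_prod => a _.
Qed.

(** Cramer's rule. *)
Lemma measurable_invmx d (T : measurableType d) (D : set T) m (A : T -> 'M[R]_m) :
  measurable D -> (forall x, D x -> A x \in unitmx) ->
  (forall a b, measurable_fun D (fun x => A x a b)) ->
  forall a b, measurable_fun D (fun x => invmx (A x) a b).
Proof.
move=> mD uA mA a b.
apply: (eq_measurable_fun (fun x => (\det (A x))^-1 * cofactor (A x) b a)).
  by move=> x; rewrite inE => Dx; rewrite /invmx uA// !mxE.
apply: measurable_funM.
  apply: measurable_inv => //; last exact: measurable_det.
  by move=> x Dx; have := uA x Dx; rewrite unitmxE unitfE.
apply: measurable_funM => //; apply: measurable_det => a' b'.
by under eq_fun do rewrite !mxE; exact: mA.
Qed.

End measurable_matrix.

Section borel_measurability.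
Context {R : realType} {n : nat} {M : riemannian R n}.
Implicit Types (x y : M) (i j : chart M) (W : set M).

Lemma open_borel W : open W -> measurable (W : set (borel M)).
Proof. by move=> oW; exact: sub_sigma_algebra. Qed.

Lemma preimage_open (U : topologicalType) W (f : M -> U) (V : set U) :
  open W -> (forall x, W x -> {for x, continuous f}) -> open V ->
  open (W `&` f @^-1` V).
Proof.
move=> oW fc oV; rewrite openE => x [Wx Vfx]; rewrite /interior.
apply: filterI; first exact: open_nbhs_nbhs.
by apply: (fc x Wx); exact: open_nbhs_nbhs.
Qed.

Lemma continuous_borel W (f : borel M -> borel M) : open W ->
  (forall x : M, W x -> {for x, continuous (f : M -> M)}) ->
  measurable_fun (W : set (borel M)) f.
Proof.
move=> oW fc; apply: (@measurability _ _ _ _ _ f (@open M)); first reflexivity.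
by move=> _ [V oV <-]; apply: open_borel; exact: preimage_open.
Qed.

Lemma continuous_borel_real W (f : borel M -> R) : open W ->
  (forall x : M, W x -> {for x, continuous (f : M -> R)}) ->
  measurable_fun (W : set (borel M)) f.
Proof.
move=> oW fc; apply: (measurability _ (RGenOpens.measurableE R)).
move=> _ [_ [a [b ->] <-]]; apply: open_borel.
exact: preimage_open oW fc (interval_open _ _).
Qed.

Lemma measurable_gram i a b :
  measurable_fun (dom i : set (borel M)) (fun x : borel M => gram i (coord i x) a b).
Proof.
apply: continuous_borel_real; first exact: dom_open.
move=> x ix; apply: (@continuous_comp _ _ _ (coord i) (fun u => gram i u a b)).
  exact: coord_continuous.
by apply: differentiable_continuous; exact: gram_differentiable.
Qed.

Context {d} {T : measurableType d}.

(** A partial derivative is a limit of difference quotients along the steps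
  [1 / (m + 1)]. At each point these steps stay in the chart from some [m] on, and
  the quotients are altered where they leave it. *)
Lemma measurable_partial (F : M -> T -> R) i a :
  measurable_fun setT (fun p : borel M * T => F p.1 p.2) ->
  (forall x t, mdifferentiable (F^~ t) x) ->
  measurable_fun ((dom i : set (borel M)) `*` [set: T])
    (fun p : borel M * T => dchart i (F^~ p.2) p.1 0 a).
Proof.
move=> mF dF.
pose h m : R := @harmonic R m.
pose e : 'rV[R]_n := delta_mx 0 a.
pose W m : set M := dom i `&` coord i @^-1` (shift (h m *: e) @^-1` (coord i @` dom i)).
have shift_continuous m : continuous (shift (h m *: e)).
  move=> u; apply: differentiable_continuous.
  by apply: (differentiableD (f := id) (g := cst (h m *: e))); exact: ex_diff.
have oW m : open (W m).
  have oV : open (shift (h m *: e) @^-1` (coord i @` dom i)).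
    by apply: open_comp; [move=> *; exact: shift_continuous|exact: img_open].
  by apply: preimage_open oV; [exact: dom_open|exact: coord_continuous].
pose Tm m : borel M -> borel M :=
  (fun x : borel M => point_of i (shift (h m *: e) (coord i x)) : borel M) \_ (W m).
have mT m : measurable_fun setT (Tm m).
  apply: (measurable_restrictT _ (open_borel (oW m))).1.
  apply: continuous_borel (oW m) _ => x [ix [y iy yE]].
  apply: (@continuous_comp _ _ _ (coord i) (point_of i \o shift (h m *: e))).
    exact: coord_continuous.
  apply: (@continuous_comp _ _ _ (shift (h m *: e)) (point_of i)).
    exact: shift_continuous.
  by rewrite -yE; exact: point_of_continuous.
pose q m (p : borel M * T) : R := (h m)^-1 * (F (Tm m p.1) p.2 - F p.1 p.2).
have mq m : measurable_fun setT (q m).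
  have mTm : measurable_fun setT (fun p : borel M * T => (Tm m p.1, p.2)).
    by apply: measurable_fun_pair => //; exact: measurableT_comp (mT m) measurable_fst.
  apply: measurable_funM => //; apply: measurable_funB; last exact: mF.
  exact: measurableT_comp mF mTm.
apply: (measurable_fun_cvg (h := q)) => [m|[x t] [/= ix _]].
  exact: measurable_funTS.
rewrite mxE.
have dFx := @diff_derivable _ _ _ _ _ e (mdifferentiable_chart ix (dF x t)).
have h0 m : h m != 0 by rewrite lt0r_neq0// harmonic_gt0.
have ch : h m @[m --> \oo] --> 0 by exact: cvg_harmonic.
have := (cvgr_dnbhsP _ _ _).1 dFx h (conj h0 ch).
apply: cvg_trans; apply: near_eq_cvg.
have nearW : \forall r \near (0 : R),
    (coord i @` dom i) (shift (r *: e) (coord i x)).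
  have cs : {for 0, continuous (fun r : R => shift (r *: e) (coord i x))}.
    apply: differentiable_continuous; apply/derivable1_diffP.
    by have [] := is_derive_line (coord i x) e (0 : R).
  by apply: cs; rewrite /= scale0r addr0; exact: near_img.
have imgW : \forall m \near \oo, (coord i @` dom i) (shift (h m *: e) (coord i x)).
  exact: ch _ nearW.
near=> m; have imgm : (coord i @` dom i) (shift (h m *: e) (coord i x)).
  by near: m; exact: imgW.
have Wm : W m x by split.
rewrite /q /Tm patchE mem_set// /GRing.scale/= coordK//.
by rewrite [_ + coord i x]addrC.
Unshelve. all: by end_near. Qed.

End borel_measurability.

(** * Bounded random variables and independence *)

Section law.
Local Open Scope ereal_scope.
Context d1 d2 (T1 : measurableType d1) (T2 : measurableType d2) (R : realType).
Variables (mu : {finite_measure set T1 -> \bar R}) (f : T1 -> T2).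

(** The measurability of [f] is an argument of [law], so that the measure structure
  can be inferred from the expression. *)
Definition law (mf : measurable_fun setT f) : set T2 -> \bar R :=
  fun A => mu (f @^-1` A).

Hypothesis mf : measurable_fun setT f.

Let law0 : law mf set0 = 0.
Proof. by rewrite /law preimage_set0 measure0. Qed.

Let law_ge0 A : 0 <= law mf A.
Proof. exact: measure_ge0. Qed.

Let law_sigma_additive : semi_sigma_additive (law mf).
Proof.
move=> F mF tF mUF; rewrite /law preimage_bigcup.
apply: measure_semi_sigma_additive.
- by move=> n; rewrite -[X in measurable X]setTI; exact: mf.
- apply/trivIsetP => /= i j _ _ ij; rewrite -preimage_setI.
  by move/trivIsetP : tF => /(_ _ _ _ _ ij) ->//; rewrite preimage_set0.
- by rewrite -preimage_bigcup -[X in measurable X]setTI; exact: mf.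
Qed.

HB.instance Definition _ := isMeasure.Build _ _ _ (law mf)
  law0 law_ge0 law_sigma_additive.

Let law_fin : fin_num_fun (law mf).
Proof.
move=> A mA; apply: fin_num_measure; rewrite -[X in measurable X]setTI.
exact: mf.
Qed.

HB.instance Definition _ := @Measure_isFinite.Build _ _ _ (law mf) law_fin.

End law.

Section bounded_measurable.
Context d (T : measurableType d) (R : realType).
Implicit Types (f g : T -> R).

(** Bounded measurable functions are integrable for every finite measure and stable
  under the operations below, which settles all questions of integrability. *)
Definition bmeas f := measurable_fun setT f /\ exists B, forall x, `|f x| <= B.

Lemma bmeas_integrable (mu : {finite_measure set T -> \bar R}) f :
  bmeas f -> mu.-integrable setT (EFin \o f).
Proof.
move=> [mf [B fB]]; apply: measurable_bounded_integrable => //.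
  by rewrite -ge0_fin_numE// fin_num_measure.
by exists B; split; [exact: num_real|move=> b Bb x _; exact: le_trans (ltW Bb)].
Qed.

Lemma bmeas_cst (r : R) : bmeas (fun=> r).
Proof. by split; [exact: measurable_cst|exists `|r|]. Qed.

Lemma bmeasD f g : bmeas f -> bmeas g -> bmeas (fun x => f x + g x).
Proof.
move=> [mf [A fA]] [mg [B gB]]; split; first exact: measurable_funD.
by exists (A + B) => x; apply: le_trans (ler_normD _ _) _; exact: lerD.
Qed.

Lemma bmeasM f g : bmeas f -> bmeas g -> bmeas (fun x => f x * g x).
Proof.
move=> [mf [A fA]] [mg [B gB]]; split; first exact: measurable_funM.
by exists (A * B) => x; rewrite normrM ler_pM.
Qed.

Lemma bmeasZ (r : R) f : bmeas f -> bmeas (fun x => r * f x).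
Proof. by move=> bf; exact: bmeasM (bmeas_cst r) bf. Qed.

Lemma bmeasB f g : bmeas f -> bmeas g -> bmeas (fun x => f x - g x).
Proof.
move=> bf bg; have := bmeasD bf (bmeasZ (-1) bg).
by under [X in bmeas X -> _]eq_fun do rewrite mulN1r.
Qed.

Lemma bmeas_sum m (F : 'I_m -> T -> R) : (forall k, bmeas (F k)) ->
  bmeas (fun x => \sum_k F k x).
Proof.
move=> bF; split; first by apply: measurable_sum => k; have [] := bF k.
have hB k : exists B, forall x, `|F k x| <= B by have [] := bF k.
exists (\sum_k sval (cid (hB k))) => x.
apply: le_trans (ler_norm_sum _ _ _) _; apply: ler_sum => k _.
by case: cid.
Qed.

Section integral.
Variable mu : {finite_measure set T -> \bar R}.

Lemma RintD f g : bmeas f -> bmeas g ->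
  \int[mu]_x (f x + g x) = \int[mu]_x f x + \int[mu]_x g x.
Proof. by move=> bf bg; rewrite RintegralD//; exact: bmeas_integrable. Qed.

Lemma RintB f g : bmeas f -> bmeas g ->
  \int[mu]_x (f x - g x) = \int[mu]_x f x - \int[mu]_x g x.
Proof. by move=> bf bg; rewrite RintegralB//; exact: bmeas_integrable. Qed.

Lemma RintZ (r : R) f : bmeas f ->
  \int[mu]_x (r * f x) = r * \int[mu]_x f x.
Proof. by move=> bf; rewrite RintegralZl//; exact: bmeas_integrable. Qed.

Lemma Rint_sum m (F : 'I_m -> T -> R) : (forall k, bmeas (F k)) ->
  \int[mu]_x (\sum_k F k x) = \sum_k \int[mu]_x F k x.
Proof.
elim: m F => [|m IH] F bF.
  under eq_Rintegral do rewrite big_ord0.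
  by rewrite big_ord0 Rintegral_cst// mul0r.
under eq_Rintegral do rewrite big_ord_recl.
rewrite RintD//; last exact: bmeas_sum.
by rewrite big_ord_recl IH.
Qed.

Lemma le_Rint f g : bmeas f -> bmeas g -> (forall x, f x <= g x) ->
  \int[mu]_x f x <= \int[mu]_x g x.
Proof. by move=> bf bg fg; apply: le_Rintegral => //; exact: bmeas_integrable. Qed.

Lemma Rint_cst (r : R) : \int[mu]_x r = r * fine (mu setT).
Proof. by rewrite Rintegral_cst. Qed.

Lemma EFin_Rint f : bmeas f -> (\int[mu]_x (f x)%:E)%E = (\int[mu]_x f x)%:E.
Proof.
by move=> bf; rewrite /Rintegral fineK//; exact: integrable_fin_num (bmeas_integrable mu bf).
Qed.

Lemma Rint_norm_le f (B : R) : bmeas f -> (forall x, `|f x| <= B) ->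
  `|\int[mu]_x f x| <= B * fine (mu setT).
Proof.
move=> bf fB; rewrite ler_norml -mulNr -!Rint_cst; apply/andP; split.
  by apply: le_Rint => //; [exact: bmeas_cst|move=> x; have := fB x; rewrite ler_norml => /andP[]].
by apply: le_Rint => //; [exact: bmeas_cst|move=> x; have := fB x; rewrite ler_norml => /andP[]].
Qed.

End integral.
End bounded_measurable.

Lemma bmeas_comp d d' (T : measurableType d) (T' : measurableType d')
    (R : realType) (Y : T' -> T) (f : T -> R) :
  measurable_fun setT Y -> bmeas f -> bmeas (f \o Y).
Proof.
move=> mY [mf [B fB]]; split; first exact: measurableT_comp.
by exists B => x; exact: fB.
Qed.


Section independence.
Context (R : realType).
Context d (Omega : measurableType d) (Pr : probability Omega R).
Context d1 d2 (T1 : measurableType d1) (T2 : measurableType d2).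
Implicit Types (f : T1 * T2 -> R).

Lemma Rint_law d' (T : measurableType d') (Y : Omega -> T)
    (mY : measurable_fun setT Y) (f : T -> R) : bmeas f ->
  \int[law Pr mY]_y f y = \int[Pr]_w f (Y w).
Proof.
move=> bf; rewrite /Rintegral; congr fine.
have [mf _] := bf.
have := @integral_pushforward _ _ _ _ R Y mY Pr setT (EFin \o f).
rewrite preimage_setT; apply => //; first exact/measurable_EFinP.
exact: (bmeas_integrable Pr (bmeas_comp mY bf)).
Qed.

Lemma measurable_section (y : T1) : measurable_fun setT (fun z : T2 => (y, z)).
Proof. by apply: measurable_fun_pair => //; exact: measurable_cst. Qed.

Lemma bmeas_section f y : bmeas f -> bmeas (fun z => f (y, z)).
Proof. by move=> bf; exact: bmeas_comp (measurable_section y) bf. Qed.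

(** Independence on rectangles identifies the joint law with the product of the
  laws, to which Fubini applies. *)
Lemma Rint_indep (m2 : {finite_measure set T2 -> \bar R})
    (Y : Omega -> T1) (Z : Omega -> T2) f :
  measurable_fun setT Y -> measurable_fun setT Z ->
  (forall A B, measurable A -> measurable B ->
    Pr (Y @^-1` A `&` Z @^-1` B) = (Pr (Y @^-1` A) * m2 B)%E) ->
  bmeas f ->
  \int[Pr]_w f (Y w, Z w) = \int[Pr]_w \int[m2]_z f (Y w, z).
Proof.
move=> mY mZ indep bf; have [mf [B fB]] := bf.
have mW : measurable_fun setT (fun w => (Y w, Z w)) by exact: measurable_fun_pair.
pose F y := \int[m2]_z f (y, z).
have FE : fubini_F m2 (EFin \o f) = EFin \o F.
  by apply/funext => y; exact: EFin_Rint (bmeas_section y bf).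
have intf : (law Pr mY \x m2)%E.-integrable setT (EFin \o f).
  apply: measurable_bounded_integrable => //.
    have lt : (law Pr mY setT * m2 setT < +oo)%E.
      rewrite -ge0_fin_numE; last exact: mule_ge0.
      by rewrite fin_numM// fin_num_measure.
    rewrite -(product_measure1E (law Pr mY) m2 measurableT measurableT) in lt.
    by rewrite setXTT in lt; exact: lt.
  by exists B; split; [exact: num_real|move=> b Bb x _; exact: le_trans (ltW Bb)].
have bF : bmeas F.
  split.
    have := measurable_fubini_F intf.
    by rewrite FE => /measurable_EFinP.
  exists (B * fine (m2 setT)) => y.
  by apply: Rint_norm_le (bmeas_section y bf) _ => z; exact: fB.
rewrite -(Rint_law mW bf) -(Rint_law mY bF) /Rintegral; congr fine.
transitivity (\int[law Pr mY \x m2]_p (EFin \o f) p)%E.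
  apply: eq_measure_integral => A mA _; apply/esym.
  by apply: product_measure_unique; [exact: indep|exact: mA].
by rewrite -integral12_prod_meas1// FE.
Qed.

End independence.

Lemma measurable_fun_mem d (T : measurableType d) (N : set T) :
  measurable N -> measurable_fun setT (fun x => x \in N).
Proof.
move=> mN; apply: (measurable_fun_bool true).
rewrite (_ : _ @^-1` _ = N) ?setTI//.
by apply/seteqP; split => x /=; [move/set_mem|move/mem_set].
Qed.

Section integral_bounds.
Local Open Scope ereal_scope.
Context d (T : measurableType d) (R : realType).
Variable mu : {measure set T -> \bar R}.

(** Raising [g] to infinity on the null set [N] does not change its integral. *)
Lemma ge0_le_integral_negligible (f g : T -> \bar R) (N : set T) :
  measurable N -> mu N = 0 -> measurable_fun setT g ->
  (forall x, 0 <= f x) -> (forall x, ~ N x -> f x <= g x) ->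
  \int[mu]_x f x <= \int[mu]_x g x.
Proof.
move=> mN N0 mg f0 fg.
pose h x := if x \in N then +oo else g x.
have mh : measurable_fun setT h.
  by apply: measurable_fun_ifT => //; exact: measurable_fun_mem.
have -> : \int[mu]_x g x = \int[mu]_x h x.
  apply: ae_eq_integral => //; exists N; split => // x /= nx.
  by apply: contrapT => Nx; apply: nx => _; rewrite /h memNset.
apply: ge0_le_integral_nonmeas => // x _.
rewrite /h; case: ifPn => [_|]; first exact: leey.
by rewrite notin_setE => /fg.
Qed.

End integral_bounds.

Section independence_extension.
Context (R : realType).
Context d (Omega : measurableType d) (Pr : probability Omega R).

(** This is [Rint_indep] for the identity map to [Omega] with the sigma-algebra
  generated by [G], and for the indicator of [E] as a boolean random variable. *)
Lemma Rint_indep_event (G : set (set Omega)) (E : set Omega) (p : R)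
    (h : g_sigma_algebraType G -> R) :
  G `<=` measurable -> measurable E ->
  (forall A, <<s G >> A -> Pr (A `&` E) = (Pr A * p%:E)%E) ->
  bmeas h ->
  \int[Pr]_w (\1_E w * h w) = p * \int[Pr]_w h w.
Proof.
move=> mG mE indep bh.
have sG : <<s G >> `<=` measurable.
  by apply: smallest_sub => //; exact: sigma_algebra_measurable.
pose Y : Omega -> g_sigma_algebraType G := idfun.
have mY : measurable_fun setT Y by move=> _ B mB; rewrite setTI; exact: sG.
pose Z w : bool := w \in E.
have ZE : Z @^-1` [set true] = E.
  by apply/seteqP; split => w /=; rewrite /Z; [move/set_mem|move/mem_set].
have mZ : measurable_fun setT Z.
  by apply: (measurable_fun_bool true); rewrite setTI ZE.
have PE : Pr E = p%:E.
  rewrite -[E]setTI indep ?probability_setT ?mul1e//.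
  exact: (@measurableT _ (g_sigma_algebraType G)).
have bb : bmeas (fun b : bool => b%:R : R).
  by split; [move=> _ B mB|exists 1; case; rewrite ?normr1// normr0].
pose f (yb : g_sigma_algebraType G * bool) : R := (yb.2)%:R * h yb.1.
have bf : bmeas f.
  apply: bmeasM; first exact: bmeas_comp measurable_snd bb.
  exact: bmeas_comp measurable_fst bh.
have ind (A : set Omega) (B : set bool) : <<s G >> A ->
    measurable B ->
    Pr (A `&` Z @^-1` B) = (Pr A * law Pr mZ B)%E.
  move=> mA _; have mA' := sG A mA.
  have -> : law Pr mZ B = Pr (Z @^-1` B) by [].
  have PAE : Pr (A `&` ~` E) = (Pr A * (1 - p%:E))%E.
    have e : (Pr A = Pr (A `\` E) + Pr A * p%:E)%E.
      by rewrite -(indep _ mA); exact: measureDI.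
    rewrite -setDE; move: e.
    have : Pr A \is a fin_num by exact: fin_num_measure.
    move=> /fineK <-.
    have : Pr (A `\` E) \is a fin_num by apply: fin_num_measure; exact: measurableD.
    move=> /fineK <-; rewrite -EFinM -EFinD -EFinB -EFinM => -[e].
    by congr _%:E; rewrite mulrBr mulr1 {1}e addrK.
  have [BT|BT] := pselect (B true); have [BF|BF] := pselect (B false).
  - have -> : B = setT by apply/seteqP; split => // -[].
    by rewrite !preimage_setT setIT probability_setT mule1.
  - have -> : B = [set true] by apply/seteqP; split => -[].
    by rewrite ZE indep// PE.
  - have -> : B = ~` [set true] by apply/seteqP; split => -[] //= h; exfalso; exact: h.
    by rewrite -preimage_setC ZE PAE probability_setC// PE.
  - have -> : B = set0 by apply/seteqP; split => -[].
    by rewrite preimage_set0 setI0 !measure0 mule0.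
have := Rint_indep mY mZ ind bf; rewrite /f/=.
move=> e; transitivity (\int[Pr]_w ((Z w)%:R * h (Y w))).
  by apply: eq_Rintegral => w _; rewrite indicE.
rewrite e.
have inner y : \int[law Pr mZ]_z (z%:R * h y) = p * h y.
  under eq_Rintegral do rewrite mulrC.
  rewrite RintZ// mulrC; congr (_ * _).
  rewrite (Rint_law Pr mZ bb).
  transitivity (\int[Pr]_w (\1_E w)).
    by apply: eq_Rintegral => w _; rewrite indicE.
  have fPE : fine (Pr E) = p by rewrite PE.
  by rewrite /Rintegral integral_indic// setIT; exact: fPE.
under eq_Rintegral do rewrite inner.
by rewrite RintZ//; exact: bmeas_comp mY bh.
Qed.

Lemma rectangle_measure_unique d1 d2 (T1 : measurableType d1)
    (T2 : measurableType d2) (m1 m2 : {measure set (T1 * T2) -> \bar R}) :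
  (forall A B, measurable A -> measurable B -> m1 (A `*` B) = m2 (A `*` B)) ->
  (m1 setT < +oo)%E -> forall D, measurable D -> m1 D = m2 D.
Proof.
move=> m12 m1oo.
pose C : set (set (T1 * T2)) := [set A `*` B | A in measurable & B in measurable].
apply: (measure_unique C (fun=> setT)) => //.
- exact: measurable_prod_measurableType.
- move=> _ _ [A1 mA1 [B1 mB1 <-]] [A2 mA2 [B2 mB2 <-]].
  rewrite -setXI; exists (A1 `&` A2); first exact: measurableI.
  by exists (B1 `&` B2) => //; exact: measurableI.
- by move=> _; rewrite -setXTT; exists setT => //; exists setT.
- by rewrite bigcup_const.
- by move=> _ [A mA [B mB <-]]; exact: m12.
Qed.

(** For a fixed [B] both sides are finite measures in [D] that agree on
  rectangles. *)
Lemma indep_pair d1 d2 d3 (T1 : measurableType d1) (T2 : measurableType d2)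
    (T3 : measurableType d3) (Y1 : Omega -> T1) (Y2 : Omega -> T2)
    (Z : Omega -> T3) (P : probability T3 R) :
  measurable_fun setT Y1 -> measurable_fun setT Y2 -> measurable_fun setT Z ->
  (forall U A B, measurable U -> measurable A -> measurable B ->
    Pr (Y1 @^-1` U `&` Y2 @^-1` A `&` Z @^-1` B) =
    (Pr (Y1 @^-1` U `&` Y2 @^-1` A) * P B)%E) ->
  forall D B, measurable D -> measurable B ->
  let Y w := (Y1 w, Y2 w) in
  Pr (Y @^-1` D `&` Z @^-1` B) = (Pr (Y @^-1` D) * P B)%E.
Proof.
move=> mY1 mY2 mZ ind D B mD mB Y.
have mY : measurable_fun setT Y by exact: measurable_fun_pair.
have mZB : measurable (Z @^-1` B) by rewrite -[X in measurable X]setTI; exact: mZ.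
have PB0 : 0 <= fine (P B) by exact: fine_ge0.
have PBE : (fine (P B))%:E = P B by rewrite fineK// fin_num_measure.
pose m1 := law (mrestr Pr mZB) mY.
pose m2 := mscale (NngNum PB0) (law Pr mY).
have m12 U A : measurable U -> measurable A -> m1 (U `*` A) = m2 (U `*` A).
  move=> mU mA; have := ind U A B mU mA mB; rewrite -PBE muleC; exact.
have oo : (m1 setT < +oo)%E by rewrite -ge0_fin_numE// fin_num_measure.
have E : m1 D = m2 D := rectangle_measure_unique m12 oo mD.
by transitivity (m1 D) => //; rewrite E muleC -PBE.
Qed.

End independence_extension.

(** * Second moment of a sum of sampled gradients *)

Section gradient_pairing.
Context {R : realType} {n : nat} {M : riemannian R n}.
Implicit Types (i : chart M).

Lemma compact_borel (X : set M) : compact X -> measurable (X : set (borel M)).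
Proof.
move=> cX; rewrite -[X]setCK; apply: measurableC; apply: open_borel.
by rewrite openC; apply: compact_closed => //; exact: carrier_hausdorff.
Qed.

Context {d} {T : measurableType d}.

Lemma measurable_fst_comp (D : set (borel M)) (f : borel M -> R) :
  measurable D -> measurable_fun D f ->
  measurable_fun (D `*` [set: T]) (fun p : borel M * T => f p.1).
Proof.
move=> mD mf; apply: (@measurable_comp _ _ _ _ _ _ D f) => //.
- by move=> _ [p [Dp _] <-].
- exact: measurable_funTS.
Qed.

Lemma measurable_inner_grad_dom (F G : M -> T -> R) i :
  measurable_fun setT (fun p : borel M * T => F p.1 p.2) ->
  measurable_fun setT (fun p : borel M * T => G p.1 p.2) ->
  (forall x t, mdifferentiable (F^~ t) x) ->
  (forall x t, mdifferentiable (G^~ t) x) ->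
  measurable_fun ((dom i : set (borel M)) `*` [set: T])
    (fun p : borel M * T =>
       inner (p.1 : M) (grad (F^~ p.2) p.1) (grad (G^~ p.2) p.1)).
Proof.
move=> mF mG dF dG.
have mdom : measurable (dom i : set (borel M)) := open_borel (dom_open i).
pose I (p : borel M * T) := invmx (gram i (coord i (p.1 : M))).
apply: (eq_measurable_fun (fun p : borel M * T =>
  \sum_b (\sum_a dchart i (F^~ p.2) p.1 0 a * I p a b) *
    dchart i (G^~ p.2) p.1 0 b)).
  move=> [x t]; rewrite inE => -[/= ix _].
  by rewrite (inner_grad_grad ix (dF x t) (dG x t)) gram_formE.
apply: measurable_sum => b; apply: measurable_funM; last exact: measurable_partial.
apply: measurable_sum => a; apply: measurable_funM; first exact: measurable_partial.
apply: measurable_invmx; first exact: measurableX.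
  by move=> [x t] [/= ix _]; exact: gram_unit.
move=> a' b'; have := measurable_fst_comp mdom (@measurable_gram _ _ _ i a' b'); exact.
Qed.

(** Finitely many of the chart domains cover [X]. *)
Lemma measurable_fun_compact (X : set M) (f : borel M * T -> R) : compact X ->
  (forall i, measurable_fun ((dom i : set (borel M)) `*` [set: T]) f) ->
  measurable_fun ((X : set (borel M)) `*` [set: T]) f.
Proof.
move=> cX mf; have := cX; rewrite compact_cover.
move=> /(_ M X (fun x => dom (chart_at x))) [|x Xx|D' _ XD'].
- by move=> x _; exact: dom_open.
- by exists x => //; exact: mem_chart_at.
pose U (x : M) : set (borel M * T) :=
  (dom (chart_at x) : set (borel M)) `*` [set: T].
have mU x : measurable (U x).
  by apply: measurableX => //; apply: open_borel; exact: dom_open.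
have mbig : measurable (\bigcup_(x in [set` D']) U x).
  by apply: fin_bigcup_measurable => //; exact: finite_fset.
apply: (measurable_funS mbig).
  by move=> [x t] [/= /XD'[y Dy xy] _]; exists y.
move=> _ B mB; rewrite setI_bigcupl.
apply: fin_bigcup_measurable; first exact: finite_fset.
by move=> x _; exact: (mf (chart_at x) (mU x) B mB).
Qed.

End gradient_pairing.

Section pairing.
Context {R : realType} {n : nat} {M : riemannian R n}.
Context {d} {Xi : measurableType d}.
Variables (X : set M) (psi : M -> Xi -> R) (B : R).
Hypothesis X_compact : compact X.
Hypothesis psi_meas : measurable_fun setT (fun p : borel M * Xi => psi p.1 p.2).
Hypothesis psi_diff : forall x t, mdifferentiable (psi^~ t) x.
Hypothesis psi_bound : forall x t, X x -> tnorm x (grad (psi^~ t) x) <= B.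

(** Finitely many charts and the bound [B] are available on [X] only; the cut-off
  makes the function measurable and bounded everywhere. *)
Definition grad_pairing : borel M * (Xi * Xi) -> R :=
  (fun p : borel M * (Xi * Xi) => inner (p.1 : M)
     (grad (psi^~ p.2.1) p.1) (grad (psi^~ p.2.2) p.1))
  \_ ((X : set (borel M)) `*` [set: Xi * Xi]).

Lemma grad_pairingE x s t : X x ->
  grad_pairing (x, (s, t)) = inner x (grad (psi^~ s) x) (grad (psi^~ t) x).
Proof. by move=> Xx; rewrite /grad_pairing patchE mem_set. Qed.

Lemma norm_grad_pairing x s t : X x -> `|grad_pairing (x, (s, t))| <= B ^+ 2.
Proof.
move=> Xx; rewrite grad_pairingE//; apply: le_trans (norm_inner_le _ _ _) _.
by rewrite expr2 ler_pM ?tnorm_ge0// psi_bound.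
Qed.

Lemma grad_pairing_bmeas : bmeas grad_pairing.
Proof.
split.
  have mX := compact_borel X_compact.
  have mXT : measurable ((X : set (borel M)) `*` [set: Xi * Xi]).
    exact: measurableX.
  apply: (measurable_restrictT _ mXT).1.
  apply: measurable_fun_compact X_compact _ => i.
  have m1 : measurable_fun setT (fun p : borel M * (Xi * Xi) => psi p.1 p.2.1).
    apply: (measurableT_comp psi_meas (g := fun p => (p.1, p.2.1))).
    apply: measurable_fun_pair => //.
    exact: measurableT_comp measurable_fst measurable_snd.
  have m2 : measurable_fun setT (fun p : borel M * (Xi * Xi) => psi p.1 p.2.2).
    apply: (measurableT_comp psi_meas (g := fun p => (p.1, p.2.2))).
    apply: measurable_fun_pair => //.
    exact: measurableT_comp measurable_snd measurable_snd.
  exact: (@measurable_inner_grad_dom _ _ _ _ _ (fun x t => psi x t.1)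
    (fun x t => psi x t.2) i m1 m2 (fun x t => psi_diff x t.1)
    (fun x t => psi_diff x t.2)).
exists (B ^+ 2) => -[x [s t]].
have [Xx|nXx] := pselect (X x); first exact: norm_grad_pairing.
by rewrite /grad_pairing patchE memNset ?normr0 ?sqr_ge0// => -[].
Qed.

Variable P : probability Xi R.
Hypothesis psi_mean : forall x v, X x ->
  \int[P]_t inner x v (grad (psi^~ t) x) = 0.

Context d' (Omega : measurableType d') (Pr : probability Omega R).
Variables (x : Omega -> borel M) (K : nat) (xi : nat -> Omega -> Xi).
Hypothesis mx : measurable_fun setT x.
Hypothesis Xx : forall w, X (x w).
Hypothesis mxi : forall i, (i < K)%N -> measurable_fun setT (xi i).
Hypothesis fresh : forall U, measurable U ->
  forall A : 'I_K -> set Xi, (forall i, measurable (A i)) ->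
    Pr (x @^-1` U `&` [set w | forall i : 'I_K, A i (xi i w)]) =
    (Pr (x @^-1` U) * \prod_(i < K) P (A i))%E.

Lemma fresh_pair (i j : 'I_K) U A A' : i != j ->
  measurable U -> measurable A -> measurable A' ->
  Pr (x @^-1` U `&` xi i @^-1` A `&` xi j @^-1` A') =
  (Pr (x @^-1` U `&` xi i @^-1` A) * P A')%E.
Proof.
move=> ij mU mA mA'; have ji : j != i by rewrite eq_sym.
(* No condition is put on the samples other than i and j. *)
pose S Q Q' k := if k == i then Q else if k == j then Q' else [set: Xi].
have mS Q Q' k : measurable Q -> measurable Q' -> measurable (S Q Q' k).
  by move=> mQ mQ'; rewrite /S; case: ifP => // _; case: ifP.
have setE Q Q' : [set w | forall k : 'I_K, S Q Q' k (xi k w)] =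
    xi i @^-1` Q `&` xi j @^-1` Q'.
  apply/seteqP; split => w /=.
    move=> h; have := h i; have := h j.
    by rewrite /S eqxx (negPf ji) eqxx.
  move=> [Qw Q'w] k; rewrite /S; case: ifPn => [/eqP->//|_].
  by case: ifPn => [/eqP->|].
have prodE Q Q' : (\prod_(k < K) P (S Q Q' k) = P Q * P Q')%E.
  rewrite (bigD1 i)//= (bigD1 j)//= /S eqxx (negPf ji) eqxx big1 ?mule1//.
  by move=> k /andP[/negPf-> /negPf->]; exact: probability_setT.
have full Q Q' : measurable Q -> measurable Q' ->
    Pr (x @^-1` U `&` xi i @^-1` Q `&` xi j @^-1` Q') =
    (Pr (x @^-1` U) * (P Q * P Q'))%E.
  move=> mQ mQ'; rewrite -setIA -setE -prodE; apply: fresh => // k; exact: mS.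
rewrite full//.
have := full A setT mA measurableT; rewrite preimage_setT setIT => ->.
by rewrite probability_setT mule1 muleA.
Qed.

(** Given the point and the sample [i], the gradient at the sample [j] has mean
  zero. *)
Lemma pairing_off_diagonal (i j : 'I_K) : i != j ->
  \int[Pr]_w grad_pairing (x w, (xi i w, xi j w)) = 0.
Proof.
move=> ij; pose f (p : (borel M * Xi) * Xi) := grad_pairing (p.1.1, (p.1.2, p.2)).
have mi : measurable_fun setT (xi i) by exact: mxi.
have mj : measurable_fun setT (xi j) by exact: mxi.
have bf : bmeas f.
  apply: (bmeas_comp (Y := fun p : (borel M * Xi) * Xi => (p.1.1, (p.1.2, p.2))));
    last exact: grad_pairing_bmeas.
  apply: measurable_fun_pair.
    exact: measurableT_comp measurable_fst measurable_fst.
  apply: measurable_fun_pair => //.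
  exact: measurableT_comp measurable_snd measurable_fst.
have mY : measurable_fun setT (fun w => (x w, xi i w)) by exact: measurable_fun_pair.
have ind D A : measurable D -> measurable A ->
    Pr ((fun w => (x w, xi i w)) @^-1` D `&` xi j @^-1` A) =
    (Pr ((fun w => (x w, xi i w)) @^-1` D) * P A)%E.
  move=> mD mA; apply: (indep_pair mx mi mj) => // U A1 A2 mU mA1 mA2.
  exact: fresh_pair.
transitivity (\int[Pr]_w \int[P]_t f ((x w, xi i w), t)).
  exact: (Rint_indep (m2 := P) mY mj ind bf).
transitivity (\int[Pr]_w (0 : R)); last by rewrite Rint_cst mul0r.
apply: eq_Rintegral => w _.
rewrite -(psi_mean (grad (psi^~ (xi i w)) (x w)) (Xx w)).
by apply: eq_Rintegral => t _; exact: (grad_pairingE _ _ (Xx w)).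
Qed.

(** The off-diagonal terms vanish, so the second moment of a sum of [K] samples
  grows like [K] and not like [K ^+ 2]. *)
Lemma pairing_sum_le : 0 <= B ->
  \int[Pr]_w (\sum_(i < K) \sum_(j < K) grad_pairing (x w, (xi i w, xi j w)))
  <= K%:R * B ^+ 2.
Proof.
move=> B0.
have bp (i j : 'I_K) : bmeas (fun w => grad_pairing (x w, (xi i w, xi j w))).
  apply: (bmeas_comp (Y := fun w => (x w, (xi i w, xi j w))));
    last exact: grad_pairing_bmeas.
  by apply: measurable_fun_pair => //; apply: measurable_fun_pair; exact: mxi.
rewrite Rint_sum; last by move=> i; exact: bmeas_sum.
rewrite -[X in X%:R]card_ord -sum1_card natr_sum mulr_suml.
apply: ler_sum => i _; rewrite mul1r Rint_sum//.
rewrite (bigD1 i)//= big1 ?addr0; last first.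
  by move=> j ji; apply: pairing_off_diagonal; rewrite eq_sym.
apply: le_trans (ler_norm _) _.
have PT : fine (Pr setT) = 1 by rewrite probability_setT.
have := Rint_norm_le Pr (bp i i) (fun w => norm_grad_pairing _ _ (Xx w)).
by move=> h; apply: le_trans h _; rewrite [fine _]PT mulr1.
Qed.

End pairing.

(** * The noise of the stochastic gradient *)

Section gradient_rules.
Context {R : realType} {n : nat} {M : riemannian R n}.
Implicit Types (f g : M -> R) (x : M) (v : 'rV[R]_n).

Lemma mdifferentiable_scaled_diff (c : R) f g x :
  mdifferentiable f x -> mdifferentiable g x ->
  mdifferentiable (fun y => c * (f y - g y)) x.
Proof. by move=> df dg; apply: differentiableZ; exact: differentiableB. Qed.

Lemma grad_scaled_diff (c : R) f g x :
  mdifferentiable f x -> mdifferentiable g x ->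
  grad (fun y => c * (f y - g y)) x = c *: (grad f x - grad g x).
Proof.
move=> df dg; rewrite /grad -mulmxBl scalemxAl; congr (_ *m _).
apply/rowP => a; rewrite !mxE.
have dfa := @diff_derivable _ _ _ _ _ (delta_mx 0 a) df.
have dga := @diff_derivable _ _ _ _ _ (delta_mx 0 a) dg.
rewrite -(deriveB dfa dga).
exact: (deriveZ c (derivableB dfa dga)).
Qed.

Lemma mdifferentiable_continuous f x : mdifferentiable f x ->
  {for x, continuous f}.
Proof.
move=> df; pose i := chart_at x; have ix : dom i x := mem_chart_at x.
have c1 : {for x, continuous ((f \o point_of i) \o coord i)}.
  apply: continuous_comp; first exact: coord_continuous.
  exact: differentiable_continuous.
have E : \forall y \near x, (f \o point_of i \o coord i) y = f y.
  by apply: filterS (near_dom ix) => y iy /=; rewrite coordK.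
have fx := nbhs_singleton E.
rewrite /prop_for /continuous_at -fx.
by apply: cvg_trans c1; apply: near_eq_cvg; apply: filterS E => y ->.
Qed.

(** Coordinates are inner products with the vectors of the dual basis, so that the
  Cauchy-Schwarz inequality bounds them by the norm. *)
Lemma coordinate_inner x v (b : 'I_n) :
  v 0 b = inner x v (delta_mx 0 b *m invmx (gram (chart_at x) (coord (chart_at x) x))).
Proof.
have uG := gram_unit (mem_chart_at x).
rewrite /inner trmx_mul trmx_inv (gram_sym (mem_chart_at x)).
by rewrite mulmxA mulmxK// trmx_delta -colE mxE.
Qed.

Lemma coordinate_le x v (b : 'I_n) : `|v 0 b| <= tnorm x v *
  tnorm x (delta_mx 0 b *m invmx (gram (chart_at x) (coord (chart_at x) x))).
Proof. by rewrite {1}(coordinate_inner x v b); exact: norm_inner_le. Qed.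

End gradient_rules.

Section truncated_noise.
Context {R : realType} {n : nat} {M : riemannian R n}.
Context {d} {Xi : measurableType d}.
Variables (P : probability Xi R) (X : set M) (phi : M -> Xi -> R) (Phi : M -> R).
Variables (C : R) (N : set Xi).
Hypothesis C_ge0 : 0 <= C.
Hypothesis phi_meas : measurable_fun setT (fun p : borel M * Xi => phi p.1 p.2).
Hypothesis phi_diff : forall x t, mdifferentiable (phi^~ t) x.
Hypothesis Phi_diff : forall x, mdifferentiable Phi x.
Hypothesis unbiased : forall x, X x -> forall a : 'I_n,
  ('E_P[fun t => (grad (phi^~ t) x 0 a)%R])%E = (grad Phi x 0 a)%:E.
Hypothesis mN : measurable N.
Hypothesis N0 : P N = 0%E.
Hypothesis phi_bound : forall t, ~ N t -> forall x, X x ->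
  tnorm x (grad (phi^~ t) x) <= C.

(** The noise of a sampled gradient is the gradient of this function; it is cut
  off on the null set where the bound by [C] fails. *)
Definition noise (x : M) (t : Xi) : R := \1_(~` N) t * (phi x t - Phi x).

Lemma noise_meas : measurable_fun setT (fun p : borel M * Xi => noise p.1 p.2).
Proof.
apply: measurable_funM.
  apply: measurableT_comp measurable_snd.
  by apply: measurable_indic; exact: measurableC.
apply: measurable_funB => //.
apply: (measurableT_comp (f := Phi : borel M -> R)) measurable_fst.
apply: (continuous_borel_real (W := setT)); first exact: openT.
by move=> x _; exact: mdifferentiable_continuous.
Qed.

Lemma noise_diff x t : mdifferentiable (noise^~ t) x.
Proof. exact: mdifferentiable_scaled_diff. Qed.

Lemma grad_noise x t :
  grad (noise^~ t) x = \1_(~` N) t *: (grad (phi^~ t) x - grad Phi x).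
Proof. exact: (grad_scaled_diff _ (phi_diff x t) (Phi_diff x)). Qed.

Let cut (x : M) (t : Xi) : 'rV[R]_n := \1_(~` N) t *: grad (phi^~ t) x.

Let cut_le x t : X x -> tnorm x (cut x t) <= C.
Proof.
move=> Xx; rewrite /cut indicE; have [Nt|Nt] := pselect (N t).
  by rewrite memNset ?scale0r /tnorm ?inner0l ?sqrtr0//=; apply.
by rewrite mem_set// scale1r; exact: phi_bound.
Qed.

Let measurable_grad_entry x (b : 'I_n) :
  measurable_fun setT (fun t => grad (phi^~ t) x 0 b).
Proof.
pose i := chart_at x; have ix : dom i x := mem_chart_at x.
apply: (eq_measurable_fun (fun t =>
   \sum_a dchart i (phi^~ t) x 0 a * invmx (gram i (coord i x)) a b)).
  by move=> t _; rewrite [RHS]mxE.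
apply: measurable_sum => a; apply: measurable_funM; last exact: measurable_cst.
have mp := measurable_partial (i := i) a phi_meas phi_diff.
have mdom : measurable (((dom i : set (borel M)) `*` [set: Xi])).
  by apply: measurableX => //; apply: open_borel; exact: dom_open.
apply: (measurable_comp mdom _ mp (g := fun t => (x : borel M, t))).
  by move=> _ [t _ <-].
exact: measurable_section.
Qed.

Let bmeas_cut_entry x b : X x -> bmeas (fun t => cut x t 0 b).
Proof.
move=> Xx; split.
  apply: (eq_measurable_fun (fun t => \1_(~` N) t * grad (phi^~ t) x 0 b)).
    by move=> t _; rewrite [RHS]mxE.
  apply: measurable_funM; last exact: measurable_grad_entry.
  by apply: measurable_indic; exact: measurableC.
exists (C * tnorm x (delta_mx 0 b *m invmx (gram (chart_at x) (coord (chart_at x) x)))).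
move=> t; apply: le_trans (coordinate_le x _ b) _.
by rewrite ler_wpM2r ?tnorm_ge0// cut_le.
Qed.

(** The cut-off changes the integrand on a null set only. *)
Let Rint_cut_entry x b : X x -> \int[P]_t cut x t 0 b = grad Phi x 0 b.
Proof.
move=> Xx; apply: EFin_inj; rewrite -EFin_Rint; last exact: bmeas_cut_entry.
rewrite -(unbiased Xx) unlock; apply: ae_eq_integral => //.
- by apply/measurable_EFinP; have [] := bmeas_cut_entry b Xx.
- by apply/measurable_EFinP; exact: measurable_grad_entry.
exists N; split => // t /= nt; apply: contrapT => Nt; apply: nt => _.
by rewrite /cut indicE mem_set// scale1r.
Qed.

Let inner_cutE x v t : inner x v (cut x t) =
  \sum_b (v *m gram (chart_at x) (coord (chart_at x) x)) 0 b * cut x t 0 b.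
Proof. by rewrite /inner mxE; apply: eq_bigr => b _; rewrite [_^T _ _]mxE. Qed.

Let bmeas_inner_cut x v : X x -> bmeas (fun t => inner x v (cut x t)).
Proof.
move=> Xx; under eq_fun do rewrite inner_cutE.
by apply: bmeas_sum => b; apply: bmeasZ; exact: bmeas_cut_entry.
Qed.

Let Rint_inner_cut x v : X x ->
  \int[P]_t inner x v (cut x t) = inner x v (grad Phi x).
Proof.
move=> Xx; under eq_Rintegral do rewrite inner_cutE.
rewrite Rint_sum; last by move=> b; apply: bmeasZ; exact: bmeas_cut_entry.
rewrite /inner mxE; apply: eq_bigr => b _.
by rewrite RintZ ?Rint_cut_entry ?[_^T _ _]mxE//; exact: bmeas_cut_entry.
Qed.

(** The squared norm of the mean [v] is the mean of the inner products of the
  samples with [v], each at most [C] times the norm of [v]. *)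
Lemma tnorm_grad_Phi_le x : X x -> tnorm x (grad Phi x) <= C.
Proof.
move=> Xx; set v := grad Phi x.
have PT : fine (P setT) = 1 by rewrite probability_setT.
have bd t : `|inner x v (cut x t)| <= tnorm x v * C.
  apply: le_trans (norm_inner_le _ _ _) _.
  by rewrite ler_wpM2l ?tnorm_ge0// cut_le.
have := Rint_norm_le P (bmeas_inner_cut v Xx) bd.
rewrite Rint_inner_cut// -/v -tnorm_sqr [fine _]PT mulr1 ger0_norm ?sqr_ge0//.
rewrite expr2; have := tnorm_ge0 x v; rewrite le_eqVlt => /orP[/eqP<- _|v0].
  exact: C_ge0.
by rewrite ler_pM2l.
Qed.

Lemma tnorm_grad_noise_le x t : X x -> tnorm x (grad (noise^~ t) x) <= C + C.
Proof.
move=> Xx; rewrite grad_noise indicE; have [Nt|Nt] := pselect (N t).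
  rewrite memNset ?scale0r; last by apply.
  by rewrite /tnorm inner0l sqrtr0 addr_ge0.
rewrite mem_set// scale1r; apply: le_trans (tnormD _ _ _) _.
by rewrite tnormN; apply: lerD; [exact: phi_bound|exact: tnorm_grad_Phi_le].
Qed.

Lemma noise_mean x v : X x -> \int[P]_t inner x v (grad (noise^~ t) x) = 0.
Proof.
move=> Xx.
have E t : inner x v (grad (noise^~ t) x) =
    inner x v (cut x t) - inner x v (grad Phi x) * \1_(~` N) t.
  rewrite grad_noise /cut !innerZr innerDr innerNr mulrBr.
  by rewrite [X in _ - X]mulrC.
under eq_Rintegral do rewrite E.
have b1 : bmeas (\1_(~` N) : Xi -> R).
  split; first by apply: measurable_indic; exact: measurableC.
  by exists 1 => t; rewrite indicE; case: (_ \in _); rewrite ?normr1 ?normr0.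
rewrite RintB; [|exact: bmeas_inner_cut|exact: bmeasZ].
rewrite RintZ// Rint_inner_cut//.
have -> : \int[P]_t \1_(~` N) t = 1.
  rewrite /Rintegral integral_indic// ?setIT; last exact: measurableC.
  by have := probability_setC P mN; rewrite N0 sube0 => h; rewrite [X in fine X]h.
by rewrite mulr1 subrr.
Qed.

End truncated_noise.

(** * One step of the algorithm *)

Section frank_wolfe_step.
Context {R : realType} {n : nat} {M : riemannian R n}.
Variables (X : set M) (Phi : M -> R) (L D : R).
Hypothesis X_log : forall x y, X x -> X y -> log_defined x y.
Hypothesis X_convex : geodesically_convex X.
Hypothesis Phi_smooth : L_smooth L Phi.
Hypothesis D_ge0 : 0 <= D.
Hypothesis X_diam : forall x y, X x -> X y -> (dist x y <= D%:E)%E.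

Lemma tnorm_Log_le x y : X x -> X y -> tnorm x (Log x y) <= D.
Proof.
move=> Xx Xy; rewrite -lee_fin tnorm_Log; last exact: X_log.
exact: X_diam.
Qed.

Lemma Log_self x : X x -> Log x x = 0.
Proof.
move=> Xx; apply: (@tnorm_eq0 _ _ _ x); apply/eqP; rewrite eq_le tnorm_ge0 andbT.
rewrite -lee_fin tnorm_Log; last exact: X_log.
exact: dist_le_length (pw_nil x).
Qed.

Lemma fw_gap_le x h : X x ->
  (forall z, X z -> inner x (Log x z) (- grad Phi x) <= h) ->
  fw_gap X Phi x <= h.
Proof.
move=> Xx hz; apply: ge_sup; first by exists (inner x (Log x x) (- grad Phi x)), x.
by move=> _ [z Xz <-]; exact: hz.
Qed.

(** The point [x] itself is a competitor in the maximum, with value zero. *)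
Lemma fw_gap_ge0 x : X x -> 0 <= fw_gap X Phi x.
Proof.
move=> Xx; apply: ub_le_sup.
  exists (D * tnorm x (- grad Phi x)) => _ [z Xz <-].
  apply: le_trans (inner_le_tnorm _ _ _) _.
  by rewrite ler_wpM2r ?tnorm_ge0//; exact: tnorm_Log_le.
by exists x => //; rewrite Log_self// inner0l.
Qed.

(** Comparing the minimizer [y] of the sampled linear form with an arbitrary [z]
  costs the error of the sampled gradient [g] twice; the square root hidden in
  its norm is removed by the inequality of arithmetic and geometric means,
  weighted by [s]. *)
Lemma frank_wolfe_step x y g gam (s : R) : 1 <= s -> X x -> X y ->
  (forall z, X z -> inner x g (Log x y) <= inner x g (Log x z)) ->
  geodesic_to x y gam ->
  fw_gap X Phi x <= s * (Phi x - Phi (gam s^-1)) +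
    D * s * tnorm x (g - grad Phi x) ^+ 2 + (D + `|L| * D ^+ 2 / 2) / s.
Proof.
move=> s1 Xx Xy ymin hgam; have s0 : 0 < s by exact: lt_le_trans ltr01 s1.
have e01 : 0 <= s^-1 <= 1 by rewrite invr_ge0 ltW//= invf_le1.
have des := descent X_log X_convex Phi_smooth Xx Xy hgam e01.
apply: fw_gap_le => // z Xz.
pose delta := g - grad Phi x; pose t := tnorm x delta.
have gE : g = grad Phi x + delta by rewrite /delta addrC subrK.
have ny := tnorm_Log_le Xx Xy; have nz := tnorm_Log_le Xx Xz.
have t0 : 0 <= t := tnorm_ge0 x delta.
have ginner v : inner x g v = inner x (grad Phi x) v + inner x delta v.
  by rewrite -innerDl -gE.
have := ymin z Xz; rewrite !ginner => cmp.
have dz : inner x delta (Log x z) <= t * D.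
  apply: le_trans (inner_le_tnorm _ _ _) _.
  by apply: ler_wpM2l => //.
have dy : - inner x delta (Log x y) <= t * D.
  rewrite -innerNl; apply: le_trans (inner_le_tnorm _ _ _) _.
  by rewrite tnormN; apply: ler_wpM2l.
(* The sign of L is not known, whence the absolute value. *)
have quad : L / 2 * s^-1 ^+ 2 * tnorm x (Log x y) ^+ 2 <=
    `|L| * D ^+ 2 / 2 * s^-1 ^+ 2.
  have h1 : tnorm x (Log x y) ^+ 2 <= D ^+ 2.
    by rewrite ler_pXn2r// ?nnegrE ?tnorm_ge0.
  have h2 : L * tnorm x (Log x y) ^+ 2 <= `|L| * D ^+ 2.
    apply: le_trans (_ : `|L| * tnorm x (Log x y) ^+ 2 <= _).
      by rewrite ler_wpM2r ?sqr_ge0// ler_norm.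
    by rewrite ler_wpM2l.
  have h3 : 0 <= s^-1 ^+ 2 by rewrite sqr_ge0.
  have := ler_wpM2r h3 h2; lra.
have amgm : 2 * t <= s * t ^+ 2 + s^-1.
  have : 0 <= s * (t - s^-1) ^+ 2 by rewrite mulr_ge0 ?sqr_ge0// ltW.
  have -> : s * (t - s^-1) ^+ 2 = s * t ^+ 2 + s^-1 - 2 * t.
    by field; rewrite gt_eqF.
  lra.
rewrite innerNr innerC.
set a := inner x (grad Phi x) (Log x z) in cmp *.
set b := inner x (grad Phi x) (Log x y) in des cmp *.
have hb : - b <= s * (Phi x - Phi (gam s^-1)) + `|L| * D ^+ 2 / 2 / s.
  have h : s^-1 * - b <= Phi x - Phi (gam s^-1) + `|L| * D ^+ 2 / 2 * s^-1 ^+ 2.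
    by move: des quad; lra.
  have := ler_wpM2l (ltW s0) h; rewrite mulrA divff ?gt_eqF// mul1r.
  have -> : s * (Phi x - Phi (gam s^-1) + `|L| * D ^+ 2 / 2 * s^-1 ^+ 2) =
      s * (Phi x - Phi (gam s^-1)) + `|L| * D ^+ 2 / 2 / s.
    by field; rewrite gt_eqF.
  by [].
have hD : D * (2 * t) <= D * (s * t ^+ 2 + s^-1) by rewrite ler_wpM2l.
rewrite -/delta -/t.
have -> : (D + `|L| * D ^+ 2 / 2) / s = D * s^-1 + `|L| * D ^+ 2 / 2 / s.
  by rewrite mulrDl.
move: hD hb cmp dz dy; lra.
Qed.

End frank_wolfe_step.

(** * Summation over the run *)

Section compact_bounds.
Context {R : realType} {n : nat} {M : riemannian R n}.

Lemma mdifferentiable_bounded (X : set M) (f : M -> R) : compact X ->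
  (forall x, mdifferentiable f x) ->
  exists2 B : R, 0 <= B & forall x, X x -> `|f x| <= B.
Proof.
move=> cX df; pose P (B : R) x := `|f x| <= B.
have cov : forall x, X x -> \forall x' \near x & B \near +oo, P B x'.
  move=> x _; have fx := mdifferentiable_continuous (df x).
  have near1 : \forall y \near x, `|f x - f y| < 1.
    by have /cvgrPdist_lt/(_ _ ltr01) := fx.
  exists ([set y | `|f x - f y| < 1], [set B | `|f x| + 1 <= B]).
    by split; [exact: near1|exact: (nbhs_pinfty_ge (num_real _))].
  move=> [y B] /= [h1 h2]; rewrite /P; apply: le_trans h2.
  rewrite -[f y](subKr (f x)); apply: le_trans (ler_normB _ _) _.
  by rewrite lerD2l ltW.
have [A [_ hA]] := (compact_near_coveringP X).1 cX R _ P _ cov.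
have hB := hA (Num.max 0 A + 1).
exists (Num.max 0 A + 1); first by rewrite addr_ge0// le_max lexx.
by apply: hB; rewrite /= (@le_lt_trans _ _ (Num.max 0 A))// ?le_max ?lexx ?orbT// ltrDl.
Qed.

Lemma restrict_bmeas (X : set M) (f : M -> R) (B : R) : compact X -> 0 <= B ->
  (forall x, mdifferentiable f x) -> (forall x, X x -> `|f x| <= B) ->
  bmeas ((f : borel M -> R) \_ (X : set (borel M))).
Proof.
move=> cX B0 df fB; split.
  apply: (measurable_restrictT _ (compact_borel cX)).1; apply: measurable_funTS.
  apply: (continuous_borel_real (W := setT)); first exact: openT.
  by move=> x _; exact: mdifferentiable_continuous.
exists B => x; rewrite patchE; case: ifPn => [/set_mem/fB//|_].
by rewrite normr0.
Qed.

End compact_bounds.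

Section past.
Context {R : realType} {n : nat} {M : riemannian R n}.
Context {d : measure_display} {Xi : measurableType d}.
Context {d' : measure_display} {Omega : measurableType d'}.
Variables (x y : nat -> Omega -> borel M) (xi : nat -> nat -> Omega -> Xi).
Variables (b : nat -> nat) (K : nat).

Lemma past_iterate k U : (k <= K)%N -> measurable U ->
  <<s past x y xi b K >> (x k @^-1` U).
Proof. by move=> kK mU; apply: sub_sigma_algebra; left; exists k, U. Qed.

Lemma past_sample k i A : (k < K)%N -> (i < b k)%N -> measurable A ->
  <<s past x y xi b K >> (xi k i @^-1` A).
Proof.
by move=> kK ib mA; apply: sub_sigma_algebra; right; right; exists k, i, A.
Qed.

End past.

Section run.
Context {R : realType} {n : nat} {M : riemannian R n}.
Variables (X : set M) (Phi : M -> R) (L C D BPhi : R) (x0 : M).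
Hypothesis X_compact : compact X.
Hypothesis X_log : forall x y, X x -> X y -> log_defined x y.
Hypothesis X_convex : geodesically_convex X.
Hypothesis Phi_smooth : L_smooth L Phi.
Hypothesis C_ge0 : 0 <= C.
Hypothesis X_x0 : X x0.
Hypothesis D_ge0 : 0 <= D.
Hypothesis X_diam : forall x y, X x -> X y -> (dist x y <= D%:E)%E.
Hypothesis BPhi_ge0 : 0 <= BPhi.
Hypothesis Phi_le : forall x, X x -> `|Phi x| <= BPhi.
Context (d : measure_display) (Xi : measurableType d) (P : probability Xi R).
Variables (phi : M -> Xi -> R) (N : set Xi).
Hypothesis phi_meas : measurable_fun setT (fun p : borel M * Xi => phi p.1 p.2).
Hypothesis phi_diff : forall x t, mdifferentiable (phi^~ t) x.
Hypothesis unbiased : forall x, X x -> forall a : 'I_n,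
  ('E_P[fun t => (grad (phi^~ t) x 0 a)%R])%E = (grad Phi x 0 a)%:E.
Hypothesis mN : measurable N.
Hypothesis N0 : P N = 0%E.
Hypothesis phi_bound : forall t, ~ N t -> forall x, X x ->
  tnorm x (grad (phi^~ t) x) <= C.
Variable K : nat.
Hypothesis K_gt0 : (0 < K)%N.
Context (d' : measure_display) (Omega : measurableType d').
Variables (Pr : probability Omega R) (x y : nat -> Omega -> borel M).
Variables (xi : nat -> nat -> Omega -> Xi) (kappa : Omega -> 'I_K).
Let s : R := Num.sqrt K%:R.
Hypothesis run : srfw_run X P phi x0 K (fun=> K) (fun=> s^-1) Pr x y xi.
Hypothesis out : uniform_output (fun=> K) Pr x y xi kappa.

Let Phi_diff : forall x, mdifferentiable Phi x := Phi_smooth.1.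

Let s_sqr : s ^+ 2 = K%:R.
Proof. by rewrite sqr_sqrtr. Qed.

Let s_ge1 : 1 <= s.
Proof. by rewrite -[leLHS]sqrtr1 ler_wsqrtr// ler1n. Qed.

Lemma iterate_in k w : (k <= K)%N -> X (x k w).
Proof.
elim: k => [_|k IH kK]; first by rewrite (run_init run).
have [gam hgam ->] := run_step run w kK.
have [Xy _] := run_argmin run w kK.
apply: (X_convex (IH (ltnW kK)) Xy hgam).
by rewrite invr_ge0 (le_trans ler01 s_ge1)/= invf_le1// (lt_le_trans ltr01).
Qed.

Let psi := noise phi Phi N.
Let pairing := grad_pairing X psi.
Let PhiX : borel M -> R := (Phi : borel M -> R) \_ (X : set (borel M)).

(** The right-hand side of [frank_wolfe_step], with the squared error of the
  minibatch gradient expanded over pairs of samples. *)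
Definition gap_bound (k : nat) (w : Omega) : R :=
  s * (PhiX (x k w) - PhiX (x k.+1 w)) +
  D * s * (K%:R^-1 ^+ 2 *
    \sum_(i < K) \sum_(j < K) pairing (x k w, (xi k i w, xi k j w))) +
  (D + `|L| * D ^+ 2 / 2) / s.

Lemma fw_gap_le_bound k w : (k < K)%N -> (forall i : 'I_K, ~ N (xi k i w)) ->
  fw_gap X Phi (x k w) <= gap_bound k w.
Proof.
move=> kK Nw; have Xx := iterate_in w (ltnW kK); have Xx' := iterate_in w kK.
have [Xy ymin] := run_argmin run w kK.
have [gam hgam xE] := run_step run w kK.
have := frank_wolfe_step X_log X_convex Phi_smooth D_ge0 X_diam s_ge1 Xx Xy ymin hgam.
rewrite -xE /gap_bound /PhiX !patchE !mem_set//.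
suff -> : tnorm (x k w) (minibatch_grad phi x xi (fun=> K) k w - grad Phi (x k w)) ^+ 2 =
  K%:R^-1 ^+ 2 * \sum_(i < K) \sum_(j < K) pairing (x k w, (xi k i w, xi k j w)) by [].
have KN0 : K%:R != 0 :> R by rewrite pnatr_eq0 -lt0n.
have -> : minibatch_grad phi x xi (fun=> K) k w - grad Phi (x k w) =
    K%:R^-1 *: \sum_(i < K) grad (psi^~ (xi k i w)) (x k w).
  under [in RHS]eq_bigr => i _.
    rewrite (grad_noise _ phi_diff Phi_diff) indicE mem_set ?scale1r; last exact: Nw.
    over.
  rewrite sumrB scalerBr; congr (_ - _).
  by rewrite sumr_const card_ord -(scaler_nat K (grad Phi _)) scalerA mulVf// scale1r.
rewrite tnorm_sqr innerZl innerZr mulrA -expr2; congr (_ * _).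
rewrite inner_suml; apply: eq_bigr => i _; rewrite inner_sumr.
by apply: eq_bigr => j _; rewrite /pairing grad_pairingE.
Qed.

Let PhiX_bmeas : bmeas PhiX.
Proof. exact: restrict_bmeas X_compact BPhi_ge0 Phi_diff Phi_le. Qed.

Let psi_bound z t : X z -> tnorm z (grad (psi^~ t) z) <= C + C.
Proof. exact: tnorm_grad_noise_le C_ge0 phi_meas phi_diff Phi_diff unbiased mN N0 phi_bound _ _. Qed.

Let pairing_bmeas : bmeas pairing.
Proof.
apply: (grad_pairing_bmeas X_compact _ _ psi_bound).
  exact: noise_meas phi_meas Phi_diff mN.
exact: noise_diff phi_diff Phi_diff.
Qed.

(** The sigma-algebra on [T] is that of [Omega] or that of the past of the run; the
  former serves integration, the latter independence of the output index. *)
Lemma gap_bound_bmeas k e (T : measurableType e) (id' : T -> Omega) :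
  measurable_fun setT (x k \o id') -> measurable_fun setT (x k.+1 \o id') ->
  (forall i, (i < K)%N -> measurable_fun setT (xi k i \o id')) ->
  [/\ bmeas (fun w => PhiX (x k (id' w))), bmeas (fun w => PhiX (x k.+1 (id' w))),
      (bmeas (fun w => \sum_(i < K) \sum_(j < K)
         pairing (x k (id' w), (xi k i (id' w), xi k j (id' w))))) &
      bmeas (fun w => gap_bound k (id' w))].
Proof.
move=> mx mx' mxi.
have b1 : bmeas (fun w => PhiX (x k (id' w))) by exact: bmeas_comp mx PhiX_bmeas.
have b2 : bmeas (fun w => PhiX (x k.+1 (id' w))) by exact: bmeas_comp mx' PhiX_bmeas.
have b3 : bmeas (fun w => \sum_(i < K) \sum_(j < K)
         pairing (x k (id' w), (xi k i (id' w), xi k j (id' w)))).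
  apply: bmeas_sum => i; apply: bmeas_sum => j.
  apply: (bmeas_comp (Y := fun w => (x k (id' w), (xi k i (id' w), xi k j (id' w))))) => //.
  apply: measurable_fun_pair => //.
  by apply: measurable_fun_pair; exact: mxi.
split => //; apply: bmeasD; last exact: bmeas_cst.
by apply: bmeasD; apply: bmeasZ; [exact: bmeasB|exact: bmeasZ].
Qed.

Let gap_bound_bmeas_Omega k : (k < K)%N ->
  [/\ bmeas (fun w => PhiX (x k w)), bmeas (fun w => PhiX (x k.+1 w)),
      bmeas (fun w => \sum_(i < K) \sum_(j < K)
         pairing (x k w, (xi k i w, xi k j w))) & bmeas (gap_bound k)].
Proof.
move=> kK; apply: (gap_bound_bmeas (id' := idfun)).
- exact: (run_measurable_x run (ltnW kK)).
- exact: (run_measurable_x run kK).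
- by move=> i iK; exact: (run_measurable_xi run kK iK).
Qed.

Let fresh_x k : (k < K)%N -> forall U, measurable U ->
  forall A : 'I_K -> set Xi, (forall i, measurable (A i)) ->
    Pr (x k @^-1` U `&` [set w | forall i : 'I_K, A i (xi k i w)]) =
    (Pr (x k @^-1` U) * \prod_(i < K) P (A i))%E.
Proof. by move=> kK U mU A mA; apply: (run_draw run kK) => //; exact: past_iterate. Qed.

Lemma bad_sample_null k i : (k < K)%N -> (i < K)%N -> Pr (xi k i @^-1` N) = 0%E.
Proof.
move=> kK iK; pose A (j : 'I_K) := if j == i :> nat then N else [set: Xi].
have mA j : measurable (A j) by rewrite /A; case: ifP.
have := fresh_x kK measurableT mA; rewrite preimage_setT setTI.
rewrite (bigD1 (Ordinal iK))//= {2}/A/= eqxx N0 mul0e mule0 => <-.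
congr (Pr _); apply/seteqP; split => w /=.
  by move=> Nw j; rewrite /A; case: eqP => // ->.
by move=> /(_ (Ordinal iK)); rewrite /A/= eqxx.
Qed.

Lemma Rint_gap_bound_le k : (k < K)%N ->
  \int[Pr]_w gap_bound k w <=
  s * (\int[Pr]_w PhiX (x k w) - \int[Pr]_w PhiX (x k.+1 w)) +
  (D * (C + C) ^+ 2 + (D + `|L| * D ^+ 2 / 2)) / s.
Proof.
move=> kK; have [b1 b2 b3 _] := gap_bound_bmeas_Omega kK.
have PT : fine (Pr setT) = 1 by rewrite probability_setT.
pose c := (D + `|L| * D ^+ 2 / 2) / s.
pose S w := \sum_(i < K) \sum_(j < K) pairing (x k w, (xi k i w, xi k j w)).
have b12 := bmeasB b1 b2; have b3' := bmeasZ (K%:R^-1 ^+ 2) b3.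
have bs1 := bmeasZ s b12; have bs2 := bmeasZ (D * s) b3'.
have -> : \int[Pr]_w gap_bound k w =
    s * (\int[Pr]_w PhiX (x k w) - \int[Pr]_w PhiX (x k.+1 w)) +
    D * s * (K%:R^-1 ^+ 2 * \int[Pr]_w S w) + c.
  rewrite -(RintZ Pr _ b3) -(RintZ Pr _ b3') -(RintB Pr b1 b2) -(RintZ Pr _ b12).
  have ec : \int[Pr]_w c = c by rewrite (Rint_cst Pr c) [fine _]PT mulr1.
  rewrite -(RintD Pr bs1 bs2) -[X in _ = _ + X]ec.
  exact: (RintD Pr (bmeasD bs1 bs2) (bmeas_cst _ c)).
rewrite -addrA lerD2l [leRHS]mulrDl lerD2r.
have s0 : 0 < s := lt_le_trans ltr01 s_ge1.
have sN0 : s != 0 by rewrite gt_eqF.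
have vle : \int[Pr]_w (\sum_(i < K) \sum_(j < K)
    pairing (x k w, (xi k i w, xi k j w))) <= K%:R * (C + C) ^+ 2.
  apply: (pairing_sum_le X_compact _ _ psi_bound (P := P)).
  - exact: noise_meas phi_meas Phi_diff mN.
  - exact: noise_diff phi_diff Phi_diff.
  - exact: noise_mean phi_meas phi_diff Phi_diff unbiased mN N0 phi_bound.
  - exact: (run_measurable_x run (ltnW kK)).
  - by move=> w; exact: iterate_in (ltnW kK).
  - by move=> i iK; exact: (run_measurable_xi run kK iK).
  - exact: fresh_x.
  - by rewrite addr_ge0.
have -> : D * (C + C) ^+ 2 / s = D * s * (K%:R^-1 ^+ 2 * (K%:R * (C + C) ^+ 2)).
  by rewrite -s_sqr; field.
by rewrite ler_wpM2l ?mulr_ge0 ?(ltW s0)// ler_wpM2l// sqr_ge0.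
Qed.

Lemma Rint_indic_gap_bound (k : 'I_K) :
  \int[Pr]_w (\1_(kappa @^-1` [set k]) w * gap_bound k w) =
  K%:R^-1 * \int[Pr]_w gap_bound k w.
Proof.
have [mE indep] := out k.
apply: (Rint_indep_event (G := past x y xi (fun=> K) K)) => //.
  move=> _ [[j [U [jK mU ->]]]|[[j [U [jK mU ->]]]|[j [i [A [jK iK mA ->]]]]]].
  - by rewrite -[X in measurable X]setTI; exact: (run_measurable_x run jK).
  - by rewrite -[X in measurable X]setTI; exact: (run_measurable_y run jK).
  - by rewrite -[X in measurable X]setTI; exact: (run_measurable_xi run jK iK).
have [] // := @gap_bound_bmeas k _
  (g_sigma_algebraType (past x y xi (fun=> K) K)) idfun.
- by move=> _ U mU; rewrite setTI; exact: past_iterate (ltnW (ltn_ord k)) mU.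
- by move=> _ U mU; rewrite setTI; exact: past_iterate (ltn_ord k) mU.
- by move=> i iK _ A mA; rewrite setTI; exact: past_sample (ltn_ord k) iK mA.
Qed.

(** Each event [kappa = k] has weight [1 / K] whatever the past. The decreases of
  [Phi] telescope to at most twice its bound, and [K = s ^+ 2]. *)
Lemma expected_gap_le :
  ('E_Pr[fun w => fw_gap X Phi (x (kappa w) w)] <=
   ((BPhi + BPhi + (D * (C + C) ^+ 2 + (D + `|L| * D ^+ 2 / 2))) / s)%:E)%E.
Proof.
(* Outside this null set every sample satisfies the bound on its gradients. *)
pose bad := \bigcup_k \bigcup_i (if (k < K)%N && (i < K)%N then xi k i @^-1` N else set0).
have [N' [mN' N'0 badN']] : Pr.-negligible bad.
  apply: negligible_bigcup => k; apply: negligible_bigcup => i.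
  case: ifPn => [/andP[kK iK]|_]; last exact: negligible_set0.
  apply/negligibleP; last exact: bad_sample_null.
  by rewrite -[X in measurable X]setTI; exact: (run_measurable_xi run kK iK).
pose H w := \sum_(k < K) \1_(kappa @^-1` [set k]) w * gap_bound k w.
have bH (k : 'I_K) : bmeas (fun w => \1_(kappa @^-1` [set k]) w * gap_bound k w).
  apply: bmeasM; last by have [] := gap_bound_bmeas_Omega (ltn_ord k).
  split; first by apply: measurable_indic; have [] := out k.
  by exists 1 => w; rewrite indicE; case: (_ \in _); rewrite ?normr1 ?normr0.
have bHs : bmeas H by exact: bmeas_sum.
apply: (@le_trans _ _ (\int[Pr]_w (H w)%:E)%E).
  rewrite unlock; apply: ge0_le_integral_negligible mN' N'0 _ _ _.
  - by apply/measurable_EFinP; case: bHs.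
  - move=> w; rewrite lee_fin.
    exact: (fw_gap_ge0 Phi X_log X_diam (iterate_in w (ltnW (ltn_ord (kappa w))))).
  move=> w Nw; rewrite lee_fin /H (bigD1 (kappa w))//= big1 ?addr0; last first.
    by move=> k /negPf kw; rewrite indicE memNset ?mul0r// => /esym/eqP; rewrite kw.
  rewrite indicE mem_set// mul1r; apply: fw_gap_le_bound => // i Ni; apply: Nw.
  by apply: badN'; exists (kappa w) => //; exists i => //; rewrite !ltn_ord.
rewrite EFin_Rint// lee_fin Rint_sum//.
have s0 : 0 < s := lt_le_trans ltr01 s_ge1.
have sN0 : s != 0 by rewrite gt_eqF.
set c1 := D * (C + C) ^+ 2 + _.
apply: le_trans (_ : \sum_(k < K) K%:R^-1 *
    (s * (\int[Pr]_w PhiX (x k w) - \int[Pr]_w PhiX (x k.+1 w)) + c1 / s) <= _).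
  apply: ler_sum => k _; rewrite Rint_indic_gap_bound.
  by rewrite ler_wpM2l ?invr_ge0//; exact: Rint_gap_bound_le.
rewrite -mulr_sumr big_split/= -mulr_sumr sumr_const card_ord.
pose I j := \int[Pr]_w PhiX (x j w).
have -> : \sum_(k < K) (\int[Pr]_w PhiX (x k w) - \int[Pr]_w PhiX (x k.+1 w)) =
    I 0%N - I K.
  rewrite -(big_mkord xpredT (fun k => I k - I k.+1)).
  under eq_bigr do rewrite -opprB.
  by rewrite sumrN telescope_sumr// opprB.
have PT : fine (Pr setT) = 1 by rewrite probability_setT.
have IB j : (j <= K)%N -> `|I j| <= BPhi.
  move=> jK; have bj : bmeas (fun w => PhiX (x j w)).
    exact: bmeas_comp (run_measurable_x run jK) PhiX_bmeas.
  have bd w : `|PhiX (x j w)| <= BPhi.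
    by rewrite /PhiX patchE mem_set; [exact/Phi_le/iterate_in|exact: iterate_in].
  by apply: le_trans (Rint_norm_le Pr bj bd) _; rewrite [fine _]PT mulr1.
have I0 := IB 0%N (leq0n K); have IK := IB K (leqnn K).
have IE : I 0%N - I K <= BPhi + BPhi.
  by apply: le_trans (ler_norm _) _; apply: le_trans (ler_normB _ _) _; exact: lerD.
have -> : (BPhi + BPhi + c1) / s = K%:R^-1 * (s * (BPhi + BPhi) + c1 / s *+ K).
  by rewrite -(mulr_natr (c1 / s) K) -s_sqr; field.
rewrite ler_wpM2l ?invr_ge0// lerD2r.
by apply: ler_wpM2l IE; exact: ltW.
Qed.

End run.

Theorem theorem3p3 (R : realType) (n : nat) (M : riemannian R n)
    (X : set M) (Phi : M -> R) (L C : R) (x0 : M)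
    (X_compact : compact X)
    (X_log : forall x y, X x -> X y -> log_defined x y)
    (X_convex : geodesically_convex X)
    (Phi_smooth : L_smooth L Phi)
    (C_ge0 : 0 <= C)
    (X_x0 : X x0) :
  exists c : R,
  forall (d : measure_display) (Xi : measurableType d) (P : probability Xi R)
    (phi : M -> Xi -> R),
    measurable_fun setT (fun p : borel M * Xi => phi p.1 p.2) ->
    (forall x xi, mdifferentiable (phi^~ xi) x) ->
    (forall x, P.-integrable setT (EFin \o phi x)) ->
    (forall x, (Phi x)%:E = 'E_P[phi x]%E) ->
    (forall x, X x -> forall a : 'I_n,
       'E_P[fun xi => (grad (phi^~ xi) x 0 a)%R]%E = (grad Phi x 0 a)%:E) ->
    {ae P, forall xi, forall x, X x -> tnorm x (grad (phi^~ xi) x) <= C} ->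
  forall (K : nat), (1 <= K)%N ->
  forall (d' : measure_display) (Omega : measurableType d')
    (Pr : probability Omega R) (x y : nat -> Omega -> borel M)
    (xi : nat -> nat -> Omega -> Xi) (kappa : Omega -> 'I_K),
    srfw_run X P phi x0 K (fun=> K) (fun=> (Num.sqrt K%:R)^-1) Pr x y xi ->
    uniform_output (fun=> K) Pr x y xi kappa ->
    ('E_Pr[fun w => fw_gap X Phi (x (kappa w) w)] <= (c / Num.sqrt K%:R)%:E)%E.
Proof.
have [BPhi BPhi0 hBPhi] := mdifferentiable_bounded X_compact Phi_smooth.1.
have dist_fin x y : X x -> X y -> dist x y \is a fin_num.
  by move=> Xx Xy; rewrite -tnorm_Log//; exact: X_log.
have [D hD] : exists D : R, forall x y, X x -> X y -> (dist x y <= D%:E)%E.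
  by apply: (compact_dist_bounded X_compact (x0 := x0)) => x Xx; split; exact: dist_fin.
(* A nonnegative bound on the distances is required below. *)
have hD' x y : X x -> X y -> (dist x y <= `|D|%:E)%E.
  by move=> Xx Xy; apply: le_trans (hD x y Xx Xy) _; rewrite lee_fin ler_norm.
exists (BPhi + BPhi + (`|D| * (C + C) ^+ 2 + (`|D| + `|L| * `|D| ^+ 2 / 2))).
move=> d Xi P phi phi_meas phi_diff _ _ unbiased [N [mN N0 phi_bound]] K K1.
move=> d' Omega Pr x y xi kappa hrun hout.
apply: (expected_gap_le X_compact X_log X_convex Phi_smooth C_ge0 X_x0
  (normr_ge0 D) hD' BPhi0 hBPhi phi_meas phi_diff unbiased mN N0 _ K1 hrun hout).
by move=> t Nt z Xz; apply: contrapT => h; apply: Nt; apply: phi_bound => /(_ z Xz).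
Qed.
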